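(* Let $\mathcal{S}$ and $\mathcal{T}$ be operator systems. If $\mathcal{S}$ $\Delta_{\rm env}$-embeds in $\mathcal{T}$ and $\mathcal{T}$ $\Delta_{\rm env}$-embeds in $\mathcal{S}$, then there exist projections $p$ in the commutant of $\mathrm{C}^*_{\rm env}(\mathcal{T})^{**}$ and $q$ in the commutant of $\mathrm{C}^*_{\rm env}(\mathcal{S})^{**}$ such that $p[\iota_{\rm env}^{**}(\mathcal{T})]$ is $\Delta$-equivalent to $q[\iota_{\rm env}^{**}(\mathcal{S})]$ and $(1-p)[\iota_{\rm env}^{**}(\mathcal{T})]$ is $\Delta$-equivalent to $(1-q)[\iota_{\rm env}^{**}(\mathcal{S})]$.
   Context: An operator system is a (not necessarily closed) selfadjoint subspace of some $\mathcal{B}(H)$ containing $I_H$. For an operator system $\mathcal{T}$, $\iota_{\rm env}:\mathcal{T}\to\mathrm{C}^*_{\rm env}(\mathcal{T})$ is the canonical embedding in the C*-envelope, and $\iota_{\rm env}^{**}:\mathcal{T}\to\mathrm{C}^*_{\rm env}(\mathcal{T})\hookrightarrow\mathrm{C}^*_{\rm env}(\mathcal{T})^{**}$ its composition with the inclusion in the double dual, a von Neumann algebra acting on the universal representation space of $\mathrm{C}^*_{\rm env}(\mathcal{T})$; commutants are taken there. For a projection $p$ commuting with $\iota_{\rm env}^{**}(\mathcal{T})$, $p[\iota_{\rm env}^{**}(\mathcal{T})]$ denotes the operator system $\{p\,\iota_{\rm env}^{**}(t):t\in\mathcal{T}\}$ acting on the range of $p$ (with unit $p$; it is zero when $p=0$).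 $\mathcal{S}$ $\Delta_{\rm env}$-embeds in $\mathcal{T}$ if $\mathcal{S}$ is $\Delta$-equivalent to $p[\iota_{\rm env}^{**}(\mathcal{T})]$ for some projection $p\in\iota_{\rm env}^{**}(\mathcal{T})'$. Here $[\mathcal{V}]$ for a set of operators or products (as in $[\mathcal{M}^*\mathcal{M}]$) is norm-closed linear span. A TRO is a linear subspace $\mathcal{M}\subseteq\mathcal{B}(H,K)$ with $\mathcal{M}\mathcal{M}^*\mathcal{M}\subseteq\mathcal{M}$; it is non-degenerate if $I_H\in[\mathcal{M}^*\mathcal{M}]$ and $I_K\in[\mathcal{M}\mathcal{M}^*]$. Concrete operator systems $\mathcal{S}\subseteq\mathcal{B}(H)$, $\mathcal{T}\subseteq\mathcal{B}(K)$ are TRO-equivalent if there is a non-degenerate TRO $\mathcal{M}\subseteq\mathcal{B}(H,K)$ with $\mathcal{M}^*\mathcal{T}\mathcal{M}\subseteq\overline{\mathcal{S}}$ and $\mathcal{M}\mathcal{S}\mathcal{M}^*\subseteq\overline{\mathcal{T}}$. Operator systems are $\Delta$-equivalent if they have unital complete order embeddings with TRO-equivalent images. *)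

(* Defs.v *)
From HB Require Import structures.
From mathcomp Require Import all_boot all_order all_algebra sesquilinear complex.
From mathcomp Require Import all_classical all_reals all_analysis.

Set Implicit Arguments.
Unset Strict Implicit.
Unset Printing Implicit Defensive.
Import Order.TTheory GRing.Theory Num.Theory numFieldNormedType.Exports.
Local Open Scope classical_set_scope.
Local Open Scope ring_scope.
Local Open Scope complex_scope.

(* Complex Hilbert spaces, of arbitrary dimension (0 included); the inner
   product is linear in its first argument. *)
HB.mixin Record CompleteNormedModule_isHilbert (R : realType) H
    & CompleteNormedModule R[i] H := {
  dotp : {dot H for (@Num.conj R[i])};
  dotpp_norm : forall x : H, dotp x x = `|x| ^+ 2
}.

#[short(type="hilbertType")]
HB.structure Definition Hilbert (R : realType) :=
  {H of CompleteNormedModule R[i] H & CompleteNormedModule_isHilbert R H}.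

Section Operators.
Context {R : realType}.
Implicit Types H K L : hilbertType R.

Definition bop {H K} : set (H -> K) :=
  [set f | linear f /\ exists M : R[i], forall x, `|f x| <= M * `|x|].

Definition adjoint {H K} (f : H -> K) (g : K -> H) :=
  forall x y, dotp (f x) y = dotp x (g y).

Definition subspace {V : lmodType R[i]} (A : set V) :=
  A 0 /\ forall (k : R[i]) x y, A x -> A y -> A (k *: x + y).

Definition lspan {V : lmodType R[i]} (A : set V) : set V := smallest subspace A.

(* closure in B(H, K) for the operator norm *)
Definition opclosure {H K} (A : set (H -> K)) : set (H -> K) :=
  [set f | bop f /\ forall e : R[i], 0 < e ->
     exists2 g, A g & forall x, `|f x - g x| <= e * `|x|].

Definition clspan {H K} (A : set (H -> K)) := opclosure (lspan A).

(* positivity of a matrix of operators on H, acting on H^n *)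
Definition mxpos {H n} (s : 'M[H -> H]_n) :=
  forall x : 'I_n -> H, 0 <= \sum_(i < n) \sum_(j < n) dotp (s i j (x j)) (x i).

Definition commutant {H} (A : set (H -> H)) : set (H -> H) :=
  [set b | bop b /\ forall a, A a -> a \o b = b \o a].

Definition operator_system {H} (S : set (H -> H)) :=
  [/\ S `<=` bop, subspace S, forall s s', S s -> adjoint s s' -> S s'
    & S idfun].

(* Maps defined on a set of operators are represented by total functions of
   which only the restriction to that set matters. *)
Definition linear_on {V W : lmodType R[i]} (A : set V) (f : V -> W) :=
  forall (k : R[i]) a b, A a -> A b -> f (k *: a + b) = k *: f a + f b.

(* unital complete order embeddings S -> B(K) *)
Definition ucoe {H K} (S : set (H -> H)) (phi : (H -> H) -> (K -> K)) :=
  [/\ forall s, S s -> bop (phi s),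
      linear_on S phi,
      phi idfun = idfun
    & forall n (s : 'M[H -> H]_n), (forall i j, S (s i j)) ->
        mxpos s <-> mxpos (map_mx phi s)].

Definition TRO {H K} (M : set (H -> K)) :=
  [/\ M `<=` bop, subspace M
    & forall a b b' c, M a -> M b -> M c -> adjoint b b' -> M (a \o b' \o c)].

Definition nondegenerate {H K} (M : set (H -> K)) :=
  clspan [set f | exists a a' b, [/\ M a, M b, adjoint a a' & f = a' \o b]]
    idfun /\
  clspan [set f | exists a b b', [/\ M a, M b, adjoint b b' & f = a \o b']]
    idfun.

Definition TRO_equivalent {H K} (S : set (H -> H)) (T : set (K -> K)) :=
  exists M : set (H -> K), [/\ TRO M, nondegenerate M,
    forall a a' b t, M a -> M b -> adjoint a a' -> T t ->
      opclosure S (a' \o t \o b)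
    & forall a b b' s, M a -> M b -> adjoint b b' -> S s ->
      opclosure T (a \o s \o b')].

Definition Delta_equivalent {H K} (S : set (H -> H)) (T : set (K -> K)) :=
  exists (H' K' : hilbertType R) (phi : (H -> H) -> (H' -> H'))
      (psi : (K -> K) -> (K' -> K')),
    [/\ ucoe S phi, ucoe T psi & TRO_equivalent (phi @` S) (psi @` T)].

Definition cstar_subalgebra {H} (A : set (H -> H)) :=
  [/\ A `<=` bop, subspace A, forall a b, A a -> A b -> A (a \o b),
      forall a a', A a -> adjoint a a' -> A a'
    & opclosure A `<=` A].

Definition cstar_gen {H} (X : set (H -> H)) : set (H -> H) :=
  smallest cstar_subalgebra X.

(* *-homomorphisms from a C*-algebra of operators A to B(K) *)
Definition star_morphism {H K} (A : set (H -> H))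
    (pi : (H -> H) -> (K -> K)) :=
  [/\ forall a, A a -> bop (pi a), linear_on A pi,
      forall a b, A a -> A b -> pi (a \o b) = pi a \o pi b
    & forall a a', A a -> adjoint a a' -> adjoint (pi a) (pi a')].

(* The C*-envelope, by its universal property: iota is a unital complete order
   embedding, and every unital complete order embedding j of S induces a
   *-epimorphism C*(j(S)) -> C*(iota(S)) carrying j to iota. *)
Definition is_cstar_envelope {H K} (S : set (H -> H))
    (iota : (H -> H) -> (K -> K)) :=
  ucoe S iota /\
  forall (L : hilbertType R) (j : (H -> H) -> (L -> L)), ucoe S j ->
    exists pi : (L -> L) -> (K -> K),
      [/\ star_morphism (cstar_gen (j @` S)) pi,
          pi @` cstar_gen (j @` S) = cstar_gen (iota @` S)
        & forall s, S s -> pi (j s) = iota s].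

Definition is_state {H} (A : set (H -> H)) (f : (H -> H) -> R[i]) :=
  [/\ linear_on A (f : _ -> R[i]^o),
      forall a, A a -> (forall x, 0 <= dotp (a x) x) -> 0 <= f a
    & f idfun = 1].

(* The universal representation of a unital C*-algebra A: up to unitary
   equivalence, the Hilbert direct sum over all states f of A of the GNS
   representations (H_f, pi_f, xi_f), where xi_f is cyclic for H_f and
   <pi_f(a) xi_f, xi_f> = f(a).  States are identified when they agree on A. *)
Definition is_universal_rep {K L} (A : set (K -> K))
    (rho : (K -> K) -> (L -> L)) :=
  star_morphism A rho /\
  exists xi : ((K -> K) -> R[i]) -> L,
    [/\ forall f, is_state A f ->
          forall a, A a -> dotp (rho a (xi f)) (xi f) = f a,
        forall f g, is_state A f -> is_state A g -> {in A, f =1 g} ->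
          xi f = xi g,
        forall f g, is_state A f -> is_state A g -> ~ {in A, f =1 g} ->
          forall a b, A a -> A b -> dotp (rho a (xi f)) (rho b (xi g)) = 0
      & dense (lspan [set v | exists f a,
                 [/\ is_state A f, A a & v = rho a (xi f)]])].

End Operators.

Record projector {R : realType} (H : hilbertType R) := Projector {
  proj_fun :> H -> H;
  proj_bop : bop proj_fun;
  proj_idem : proj_fun \o proj_fun = proj_fun;
  proj_sadj : adjoint proj_fun proj_fun
}.

Section Complement.
Context {R : realType} {H : hilbertType R} (p : projector H).

Let q (x : H) := x - p x.

Lemma projC_bop : bop q.
Proof.
have [pl [M pM]] := proj_bop p; split.
  move=> k x y; rewrite /q pl scalerBr opprD -!addrA; congr (_ + _).
  by rewrite addrCA.
exists (1 + M) => x; rewrite mulrDl mul1r.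
by rewrite (le_trans (ler_normB _ _))// lerD2l.
Qed.

Lemma projC_idem : q \o q = q.
Proof.
have [pl _] := proj_bop p.
apply/funext => x /=; rewrite /q.
have -> : p (x - p x) = 0.
  have /(congr1 (fun f => f x)) /= ppx := proj_idem p.
  by rewrite -scaleN1r addrC pl ppx scaleN1r addNr.
by rewrite subr0.
Qed.

Lemma projC_sadj : adjoint q q.
Proof. by move=> x y; rewrite /q linearBl linearBr /= (proj_sadj p). Qed.

Definition projC := Projector projC_bop projC_idem projC_sadj.

End Complement.

Record prange {R : realType} {H : hilbertType R} (p : projector H) :=
  PRange { prval :> H; _ : p prval == prval }.

Section Range.
Context {R : realType} {H : hilbertType R} (p : projector H).

HB.instance Definition _ := [isSub of prange p for @prval R H p].
HB.instance Definition _ := [Choice of prange p by <:].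

Definition prange_pred : {pred H} := [pred x | p x == x].

Lemma prange_submod : GRing.submod_closed prange_pred.
Proof.
have [pl _] := proj_bop p; split.
  rewrite inE /=; apply/eqP.
  by have := pl (-1) 0 0; rewrite scaler0 addr0 scaleN1r addNr.
by move=> k x y; rewrite !inE /= => /eqP px /eqP py; rewrite pl px py.
Qed.

HB.instance Definition _ :=
  GRing.isSubmodClosed.Build R[i] H prange_pred prange_submod.

HB.instance Definition _ :=
  GRing.SubChoice_isSubLmodule.Build R[i] H prange_pred (prange p)
    prange_submod.

Let pnorm (x : prange p) : R[i] := `|val x|.

Let pnormD x y : pnorm (x + y) <= pnorm x + pnorm y.
Proof. exact: ler_normD. Qed.
Let pnormZ (k : R[i]) x : pnorm (k *: x) = `|k| * pnorm x.
Proof. exact: normrZ. Qed.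
Let pnorm0_eq0 x : pnorm x = 0 -> x = 0.
Proof. by move/normr0_eq0 => x0; apply: val_inj. Qed.

HB.instance Definition _ :=
  Lmodule_isNormed.Build R[i] (prange p) pnormD pnormZ pnorm0_eq0.

Lemma prange_fixed (x : prange p) : p (val x) = val x.
Proof. by apply/eqP; exact: (valP x). Qed.

Lemma prange_closed : closed [set x : H | p x = x].
Proof.
have [_ [M pM]] := projC_bop p.
move=> x clx /=; apply/eqP/contraT => npx.
have d0 : 0 < `|x - p x| by rewrite normr_gt0 subr_eq0 eq_sym.
have M0 : 0 < `|M| + 1 by rewrite ltr_wpDl.
have [y [/= py]] := clx _ (nbhsx_ballx x _ (divr_gt0 d0 M0)).
rewrite -ball_normE /ball_ /= ltr_pdivlMr// => xyd.
have [ql _] := projC_bop p.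
have qE : x - p x = (x - y) - p (x - y).
  have /= := ql (-1) y x; rewrite py subrr scaler0 add0r => <-.
  by rewrite scaleN1r (addrC (- y)).
suff : `|x - p x| < `|x - p x| by rewrite ltxx.
apply: le_lt_trans xyd; rewrite {1}qE (le_trans (pM _))// mulrC.
have [->|xy0] := eqVneq x y; first by rewrite subrr normr0 !mul0r.
have nxy : 0 < `|x - y| by rewrite normr_gt0 subr_eq0.
rewrite ler_wpM2l//.
have M0' : 0 <= M.
  by rewrite -(pmulr_lge0 _ nxy) (le_trans _ (pM _)).
by rewrite ger0_norm// lerDl.
Qed.

Lemma prange_complete (F : set_system (prange p)) :
  ProperFilter F -> cauchy F -> cvg F.
Proof.
move=> FF /cauchy_ballP Fc.
pose G := (val : prange p -> H) @ F.
have bE (x y : prange p) e : ball (val x) e (val y) = ball x e y.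
  by rewrite -!ball_normE.
have /cvg_ex[l Gl] : cvg G.
  apply: cauchy_cvg; apply/cauchy_ballP => e e0.
  rewrite /G near_map2; move: (Fc e e0); apply: (@filterS _ (filter_prod F F)).
  by move=> [x y] /=; rewrite bE.
have pl : p l = l.
  by apply: (closed_cvg _ prange_closed _ _ Gl); apply: nearW => x;
     exact: prange_fixed.
apply/cvg_ex; exists (PRange (introT eqP pl)).
apply/cvg_ballP => e e0; have /cvg_ballP /(_ e e0) := Gl.
by rewrite /G !near_map; apply: filterS => x; rewrite -bE.
Qed.

HB.instance Definition _ :=
  Uniform_isComplete.Build (prange p) prange_complete.

Definition prange_dotp (x y : prange p) : R[i] := dotp (val x) (val y).

Let dotl u : GRing.linear_for *%R (prange_dotp ^~ u).
Proof.
by move=> k x y; rewrite /prange_dotp /= linearDl /= linearZl_LR.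
Qed.

Let dotr u : GRing.linear_for (@Num.conj R[i] \; *%R) (prange_dotp u).
Proof.
by move=> k x y; rewrite /prange_dotp /= linearDr /= linearZr.
Qed.

HB.instance Definition _ := bilinear_isBilinear.Build R[i] (prange p) (prange p)
  R[i] *%R (@Num.conj R[i] \; *%R) prange_dotp (dotl, dotr).

Let dot_herm (x y : prange p) :
  prange_dotp x y = (-1) ^+ false * Num.conj (prange_dotp y x).
Proof. by rewrite /prange_dotp; exact: (@hermitian_subproof _ _ _ _ dotp). Qed.

HB.instance Definition _ := isHermitianSesquilinear.Build R[i] (prange p)
  false (@Num.conj R[i]) prange_dotp dot_herm.

Let dot_gt0 (x : prange p) : x != 0 -> 0 < prange_dotp x x.
Proof.
by move=> x0; rewrite /prange_dotp dotpp_norm exprn_gt0// normr_gt0.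
Qed.

HB.instance Definition _ :=
  isDotProduct.Build R[i] (prange p) prange_dotp dot_gt0.

Let dot_norm (x : prange p) : prange_dotp x x = `|x| ^+ 2.
Proof. exact: dotpp_norm. Qed.

HB.instance Definition _ := CompleteNormedModule_isHilbert.Build R (prange p)
  dot_norm.

Lemma prange_proj (y : H) : p (p y) == p y.
Proof. by apply/eqP; have /(congr1 (fun f => f y)) := proj_idem p. Qed.

Definition compress (t : H -> H) (x : prange p) : prange p :=
  PRange (prange_proj (t x)).

End Range.

(* p[X], acting on the range of p *)
Definition compression {R : realType} {H : hilbertType R} (p : projector H)
    (X : set (H -> H)) : set (prange p -> prange p) := compress (p := p) @` X.

Arguments compression {R H} p X.

(* A C*-envelope (env_space, env_map) of T with the universal representation
   univ_map of C*_env(T) on univ_space. *)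
Record envelope_data {R : realType} {H : hilbertType R} (T : set (H -> H)) :=
  EnvelopeData {
    env_space : hilbertType R;
    env_map : (H -> H) -> (env_space -> env_space);
    env_axiom : is_cstar_envelope T env_map;
    univ_space : hilbertType R;
    univ_map : (env_space -> env_space) -> (univ_space -> univ_space);
    univ_axiom : is_universal_rep (cstar_gen (env_map @` T)) univ_map
  }.

Arguments env_space {R H T} E : rename.
Arguments env_map {R H T} E _ : rename.
Arguments env_axiom {R H T} E : rename.
Arguments univ_space {R H T} E : rename.
Arguments univ_map {R H T} E _ : rename.
Arguments univ_axiom {R H T} E : rename.

Section Envelope.
Context {R : realType} {H : hilbertType R} {T : set (H -> H)}
  (E : envelope_data T).

Definition cstar_env := cstar_gen (env_map E @` T).

(* iota_env^** (T) *)
Definition env_image := (univ_map E \o env_map E) @` T.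

(* C*_env(T)^**, the von Neumann algebra generated by the universal
   representation *)
Definition env_bidual := commutant (commutant (univ_map E @` cstar_env)).

End Envelope.

Arguments cstar_env {R H T} E.
Arguments env_image {R H T} E.
Arguments env_bidual {R H T} E.

Definition Delta_env_embeds {R : realType} {H K : hilbertType R}
    (S : set (H -> H)) {T : set (K -> K)} (E : envelope_data T) :=
  exists p : projector (univ_space E), commutant (env_image E) p /\
    Delta_equivalent S (compression p (env_image E)).

(* Main.v *)
(* Proof idea.  Let A be the C*-envelope of T and rho its universal
   representation on U; let p0 be a projection commuting with rho(A).  A
   Hilbert-hotel phenomenon occurs in U: unless p0 = 1, there is a projection
   p1 commuting with rho(A) such that p1[T] and p0[T] carry the same matrix
   order while 1 - p1 is faithful, so that (1 - p1)[T] is completely order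
   isomorphic to T.  Indeed p1 is the projection onto the sum of the GNS spaces
   of the states f that factor through p0 and for which Re f(a0) - k is
   rational, for suitable a0 in A and real k: by the intermediate value theorem
   every vector is a limit of vectors whose states take such (resp. other)
   values at a0, so that both p1 and 1 - p1 see enough states.  When no a0 is
   suitable, A acts by scalars, U is at most a line and p0 is 0 or 1.

   Applying this to both systems, S ~ p0[T] and T ~ q0[S] give
   (1 - p1)[T] = T ~ q0[S] = q1[S] and p1[T] = p0[T] ~ S = (1 - q1)[S], where
   = stands for complete order isomorphism, under which Delta-equivalence is
   invariant.  If p0 = 1 or q0 = 1, take p = q = 1. *)

From Pilot Require Import Defs.
From mathcomp Require Import all_boot all_order all_algebra sesquilinear complex.
From mathcomp Require Import all_classical all_reals all_analysis.
From mathcomp Require Import ring lra.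
(* mathcomp-analysis has its own [subspace], which would shadow that of Defs. *)
Import Pilot.Defs.

Set Implicit Arguments.
Unset Strict Implicit.
Unset Printing Implicit Defensive.
Import Order.TTheory GRing.Theory Num.Theory numFieldNormedType.Exports.
Local Open Scope classical_set_scope.
Local Open Scope ring_scope.
Local Open Scope complex_scope.

(** * Hilbert space geometry *)

Section Hilbert.
Context {R : realType}.
Implicit Types H K L : hilbertType R.

Lemma dotpC H (x y : H) : dotp x y = Num.conj (dotp y x).
Proof. by rewrite hermC mul1r. Qed.

Lemma dotp_ge0 H (x : H) : 0 <= dotp x x.
Proof. by rewrite dotpp_norm exprn_ge0. Qed.

Lemma dotp_eq0 H (x : H) : dotp x x = 0 -> x = 0.
Proof. by rewrite dotpp_norm => /eqP; rewrite sqrf_eq0 normr_eq0 => /eqP. Qed.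

Lemma dotpZl H (k : R[i]) (x y : H) : dotp (k *: x) y = k * dotp x y.
Proof. by rewrite linearZl_LR. Qed.

Lemma dotpZr H (k : R[i]) (x y : H) : dotp x (k *: y) = Num.conj k * dotp x y.
Proof. by rewrite linearZr_LR. Qed.

Lemma dotpDl H (x y z : H) : dotp (x + y) z = dotp x z + dotp y z.
Proof. exact: linearDl. Qed.

Lemma dotpDr H (x y z : H) : dotp x (y + z) = dotp x y + dotp x z.
Proof. exact: linearDr. Qed.

Lemma dotpBl H (x y z : H) : dotp (x - y) z = dotp x z - dotp y z.
Proof. exact: linearBl. Qed.

Lemma dotpBr H (x y z : H) : dotp x (y - z) = dotp x y - dotp x z.
Proof. exact: linearBr. Qed.

Lemma dotp0l H (x : H) : dotp 0 x = 0.
Proof. exact: linear0l. Qed.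

Lemma dotp0r H (x : H) : dotp x 0 = 0.
Proof. exact: linear0r. Qed.

Lemma dotp_suml H (I : Type) (r : seq I) (P : pred I) (F : I -> H) y :
  dotp (\sum_(i <- r | P i) F i) y = \sum_(i <- r | P i) dotp (F i) y.
Proof. exact: linear_sumlz. Qed.

Lemma dotp_sumr H (I : Type) (r : seq I) (P : pred I) (F : I -> H) y :
  dotp y (\sum_(i <- r | P i) F i) = \sum_(i <- r | P i) dotp y (F i).
Proof. exact: linear_sumr. Qed.

Lemma dotp_extl H (x y : H) : (forall z, dotp x z = dotp y z) -> x = y.
Proof.
move=> xy; apply/eqP; rewrite -subr_eq0; apply/eqP/dotp_eq0.
by rewrite linearBl /= xy subrr.
Qed.

Lemma dotp_extr H (x y : H) : (forall z, dotp z x = dotp z y) -> x = y.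
Proof. by move=> xy; apply: dotp_extl => z; rewrite dotpC xy -dotpC. Qed.

Lemma cauchy_schwarz H (x y : H) : `|dotp x y| <= `|x| * `|y|.
Proof.
have [->|y0] := eqVneq y 0; first by rewrite linear0r !normr0 mulr0.
have ny0 : dotp y y != 0 by apply: contra_neq y0; exact: dotp_eq0.
pose a := dotp x y / dotp y y; pose z := x - a *: y.
have zy : dotp z y = 0 by rewrite linearBl /= dotpZl divfK// subrr.
have : dotp x x = dotp z z + dotp (a *: y) (a *: y).
  rewrite -[in LHS](subrK (a *: y) x) -/z hnormDd//.
  by rewrite [LHS]dotpZr zy mulr0.
rewrite dnormZ !dotpp_norm => xE.
have : `|a| ^+ 2 * `|y| ^+ 2 <= `|x| ^+ 2 by rewrite xE lerDr exprn_ge0.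
rewrite -exprMn ler_pXn2r// ?nnegrE ?mulr_ge0// => axy.
rewrite (le_trans _ (ler_wpM2r (normr_ge0 y) axy))//.
rewrite -mulrA -expr2 -dotpp_norm -(ger0_norm (dotp_ge0 y)) -normrM divfK//.
Qed.

(** The order of [R[i]] is partial, so being real is part of the claim; both follow at once from [x]
    coinciding with its modulus. *)
Lemma ge0_approx (x : R[i]) :
  (forall e : R[i], 0 < e -> exists2 y, 0 <= y & `|x - y| <= e) -> 0 <= x.
Proof.
move=> xapp; suff -> : x = `|x| by [].
apply/eqP; rewrite -subr_eq0 -normr_le0; apply/ler_addgt0Pl => e e0.
have [y y0 xy] := xapp _ (divr_gt0 e0 (ltr0Sn _ 1)).
have yx : `|y - `|x| | <= e / 2.
  by rewrite distrC -{1}(ger0_norm y0) (le_trans (ler_dist_dist _ _)).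
rewrite addr0 (splitr e) -(subrK y x) -addrA (le_trans (ler_normD _ _))//.
by rewrite lerD// subrK.
Qed.

Definition hclosure {H} (A : set H) : set H :=
  [set x | forall e : R[i], 0 < e -> exists2 y, A y & `|x - y| <= e].

Definition hclosed {H} (A : set H) := hclosure A `<=` A.

Lemma subspaceZ (V : lmodType R[i]) (A : set V) (k : R[i]) x :
  subspace A -> A x -> A (k *: x).
Proof. by move=> [A0 AP] Ax; rewrite -[X in A X]addr0; exact: AP. Qed.

Lemma subspaceD (V : lmodType R[i]) (A : set V) x y :
  subspace A -> A x -> A y -> A (x + y).
Proof. by move=> [_ AP] Ax Ay; rewrite -[x]scale1r; exact: AP. Qed.

Lemma subspaceN (V : lmodType R[i]) (A : set V) x :
  subspace A -> A x -> A (- x).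
Proof. by move=> As Ax; rewrite -scaleN1r; exact: subspaceZ. Qed.

Lemma subspaceB (V : lmodType R[i]) (A : set V) x y :
  subspace A -> A x -> A y -> A (x - y).
Proof. by move=> As Ax Ay; apply: subspaceD => //; exact: subspaceN. Qed.

Lemma subspace_sum (V : lmodType R[i]) (A : set V) (I : Type) (r : seq I)
    (P : pred I) (F : I -> V) :
  subspace A -> (forall i, P i -> A (F i)) -> A (\sum_(i <- r | P i) F i).
Proof.
move=> As AF; apply: big_ind => //; first by case: As.
by move=> x y; exact: subspaceD.
Qed.

Lemma conjCR (k : R) : Num.conj k%:C = k%:C.
Proof. by apply: conj_Creal; rewrite complex_real. Qed.

Lemma gt0_complexP (e : R[i]) : 0 < e -> exists2 r : R, 0 < r & e = r%:C.
Proof.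
move=> e0; have eE : (complex.Re e)%:C = e by apply/RRe_real/gtr0_real.
by exists (complex.Re e) => //; rewrite -ltcR eE.
Qed.

(** The projection theorem: by the parallelogram law the almost minimizers of the distance to [x]
    form a Cauchy filter, and its limit is orthogonal by a variation along [z]. *)
Lemma nearest_point H (W : set H) : subspace W -> hclosed W -> forall x,
  exists2 y, W y & forall z, W z -> dotp (x - y) z = 0.
Proof.
move=> Ws Wc x; have [W0 WP] := Ws.
pose N (z : H) : R := complex.Re (dotp z z).
have NE z : (N z)%:C = dotp z z by apply: RRe_real; exact/ger0_real/dotp_ge0.
have N0 z : 0 <= N z by rewrite -ler0c NE dotp_ge0.
pose X := [set N (x - w) | w in W]; pose d := inf X.
have Xinf : has_inf X.
  split; first by exists (N (x - 0)); exists 0.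
  by exists 0 => _ [w _ <-].
have dle w : W w -> d <= N (x - w).
  by move=> Ww; apply: ge_inf; [case: Xinf|exists w].
pose B (e : R) := [set w | W w /\ N (x - w) < d + e].
have Bn e : 0 < e -> B e !=set0.
  by move=> e0; have [_ [w Ww <-] Ne] := inf_adherent e0 Xinf; exists w.
have BI e e' w : B (Num.min e e') w -> B e w /\ B e' w.
  move=> [Ww]; rewrite addr_minr lt_min => /andP[Ne Ne'].
  by split; split.
pose F := filter_from [set e : R | 0 < e] B.
have FF : ProperFilter F.
  apply: filter_from_proper; last by move=> e; exact: Bn.
  apply: filter_from_filter; first by exists 1; exact: ltr01.
  move=> e e' /= e0 e'0; exists (Num.min e e'); first by rewrite /= lt_min e0.
  by move=> w /BI[].
have NB a b : N (a - b) = N a *+ 2 + N b *+ 2 - N (a + b).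
  apply: complexI; rewrite rmorphB rmorphD !rmorphMn /= !NE hnormB hnormD.
  by ring.
have NZ (k : R) a : N (k%:C *: a) = k ^+ 2 * N a.
  apply: complexI; rewrite rmorphM rmorphXn /= !NE dotpZl dotpZr conjCR.
  by rewrite mulrA expr2.
have Fc : cauchy F.
  apply/cauchy_ballP => _ /posnumP[e].
  have [r r0 rE] := gt0_complexP [gt0 of e%:num].
  exists (B (r ^+ 2 / 4), B (r ^+ 2 / 4)).
    by split; exists (r ^+ 2 / 4) => //=; rewrite divr_gt0// exprn_gt0.
  move=> [w w'] /= [[Ww dw] [Ww' dw']].
  rewrite -ball_normE /ball_ /= rE.
  rewrite -(ltr_pXn2r (ltn0Sn 1)) ?nnegrE ?ler0c// ?ltW//.
  rewrite -dotpp_norm -NE -rmorphXn /= ltcR.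
  have -> : w - w' = (x - w') - (x - w).
    by rewrite opprB [RHS]addrC addrA subrK.
  rewrite NB.
  (* The midpoint of [w] and [w'] lies in [W], so its squared distance to [x] is at least [d]; this
     bounds [N (w - w')] by the excess over [d]. *)
  have dm : d <= N (x - (2^-1)%:C *: (w + w')).
    by apply: dle; apply: subspaceZ => //; exact: subspaceD.
  have -> : (x - w') + (x - w) = 2%:C *: (x - (2^-1)%:C *: (w + w')).
    rewrite scalerBr scalerA -rmorphM divff// scale1r rmorph_nat.
    by rewrite scaler_nat mulr2n opprD addrACA (addrC (- w)).
  by rewrite NZ; lra.
have := @cauchy_cvg _ F FF Fc; move=> /cvg_ex[l Fl].
have lB e e' : 0 < e -> 0 < e' -> exists2 w, B e w & `|l - w| <= e'%:C.
  move=> e0 e'0; have e'c : 0 < e'%:C by rewrite ltcR.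
  have [e1 /= e10 e1B] := Fl _ (nbhsx_ballx l _ e'c).
  have [|w /BI[Bw /e1B]] := @Bn (Num.min e e1); first by rewrite lt_min e0.
  by rewrite -ball_normE => /ltW; exists w.
exists l.
  apply: Wc => _ /gt0_complexP[e e0 ->].
  by have [w [Ww _] lw] := lB _ _ ltr01 e0; exists w.
move=> z Wz; have [->|z0] := eqVneq z 0; first by rewrite linear0r.
have Nz0C : dotp z z != 0 by apply: contra_neq z0 => /dotp_eq0.
have Nz0 : 0 < N z by rewrite -ltcR NE lt_def Nz0C dotp_ge0.
(* Subtracting the best multiple [t] of [z] lowers the squared distance by exactly this square over
   [N z], and less than [e] is available above [d]. *)
have orth e w : B e w -> `|dotp (x - w) z| ^+ 2 <= (e * N z)%:C.
  move=> [Ww Ne]; pose t := dotp (x - w) z / dotp z z.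
  have : d <= N (x - (w + t *: z)).
    by apply: dle; apply: subspaceD => //; exact: subspaceZ.
  rewrite opprD addrA -lecR NE.
  have -> : dotp (x - w - t *: z) (x - w - t *: z)
      = (N (x - w))%:C - `|dotp (x - w) z| ^+ 2 / (N z)%:C.
    have tz : dotp (x - w - t *: z) z = 0.
      by rewrite linearBl /= dotpZl divfK// subrr.
    rewrite linearBr /= dotpZr tz mulr0 subr0 linearBl /= dotpZl NE.
    congr (_ - _); rewrite (dotpC z) normCK /t NE.
    by rewrite mulrAC.
  rewrite rmorphM -ler_pdivrMr ?ltcR// lerBrDr addrC -lerBrDr -rmorphB.
  by move=> /le_trans; apply; rewrite lecR; lra.
apply/eqP; rewrite -normr_le0; apply/ler_addgt0Pl => _ /gt0_complexP[h h0 ->].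
have h20 : 0 < h / 2 by rewrite divr_gt0.
have [r r0 rE] : exists2 r : R, 0 < r & `|z| = r%:C.
  by apply: gt0_complexP; rewrite normr_gt0.
(* The first tolerance bounds the product of [x - w] with [z] by [h / 2], the second does so for
   [w - l] by Cauchy-Schwarz. *)
have [w Bw lw] := lB _ _ (divr_gt0 (exprn_gt0 2 h20) Nz0) (divr_gt0 h20 r0).
rewrite addr0 (splitr h) rmorphD -(subrK w x) -addrA linearDl /=.
rewrite (le_trans (ler_normD _ _))// lerD//.
  rewrite -(ler_pXn2r (ltn0Sn 1)) ?nnegrE ?normr_ge0// ?ler0c ?(ltW h20)//.
  by rewrite (le_trans (orth _ _ Bw))// divfK ?gt_eqF// rmorphXn.
rewrite (le_trans (cauchy_schwarz _ _))// distrC rE.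
by rewrite -ler_pdivlMr ?ltcR// -fmorph_div.
Qed.

Lemma hclosure_sub H (A : set H) : A `<=` hclosure A.
Proof. by move=> x Ax e e0; exists x => //; rewrite subrr normr0 ltW. Qed.

Lemma hclosure_closed H (A : set H) : hclosed (hclosure A).
Proof.
move=> x Ax e e0; have e20 : 0 < e / 2 by rewrite divr_gt0.
have [y /(_ _ e20)[z Az yz] xy] := Ax _ e20; exists z => //.
by rewrite (splitr e) -(subrK y x) -addrA (le_trans (ler_normD _ _))// lerD.
Qed.

Lemma hclosure_subspace H (A : set H) : subspace A -> subspace (hclosure A).
Proof.
move=> [A0 AP]; split; first exact: hclosure_sub.
move=> k x y Ax Ay e e0; have e20 : 0 < e / 2 by rewrite divr_gt0.
have k0 : 0 < `|k| + 1 by rewrite ltr_wpDl.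
have [x' Ax' xx'] := Ax _ (divr_gt0 e20 k0).
have [y' Ay' yy'] := Ay _ e20.
exists (k *: x' + y'); first exact: AP.
rewrite opprD addrACA -scalerBr (splitr e) (le_trans (ler_normD _ _))// lerD//.
rewrite normrZ (le_trans (ler_wpM2l (normr_ge0 k) xx'))//.
rewrite mulrCA ler_piMr// ?(ltW e20)// ler_pdivrMr// mul1r lerDl//.
Qed.

Lemma hclosure_min H (A B : set H) : A `<=` B -> hclosed B -> hclosure A `<=` B.
Proof.
by move=> AB; apply: subset_trans => x Ax e /Ax[y /AB]; exists y.
Qed.

Lemma hclosed_orth H (A : set H) : hclosed [set x | forall y, A y -> dotp x y = 0].
Proof.
move=> x clx y Ay; apply/eqP; rewrite -normr_le0.
apply/ler_addgt0Pl => e e0; rewrite addr0.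
have y0 : 0 < `|y| + 1 by rewrite ltr_wpDl.
have [z /(_ y Ay) zy xz] := clx _ (divr_gt0 e0 y0).
rewrite -[x](subrK z) linearDl /= zy addr0 (le_trans (cauchy_schwarz _ _))//.
rewrite (le_trans (ler_wpM2r (normr_ge0 y) xz))// mulrAC ler_pdivrMr//.
by rewrite ler_wpM2l ?ltW// ltrDl.
Qed.

(** Orthogonality of the defect characterises the nearest point ([uniq], [pOE]); linearity,
    boundedness and selfadjointness are read off from it. *)
Lemma projector_onto H (W : set H) : subspace W -> hclosed W ->
  exists p : projector H, (forall x, W (p x)) /\ (forall x, W x -> p x = x).
Proof.
move=> Ws Wc; have /(_ _)/cid2-/all_sig2[p pW pO] := nearest_point Ws Wc.
have uniq x y : W y -> (forall z, W z -> dotp (x - y) z = 0) -> p x = y.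
  move=> Wy yO; apply/eqP; rewrite -subr_eq0; apply/eqP/dotp_eq0.
  have Wd : W (p x - y) by exact: subspaceB.
  have {1}-> : p x - y = (x - y) - (x - p x).
    by rewrite opprB [RHS]addrC addrA subrK.
  by rewrite linearBl /= pO// yO// subr0.
have pfix x : W x -> p x = x.
  by move=> Wx; apply: uniq => // z _; rewrite subrr linear0l.
have plin : linear p.
  move=> k x y; apply: uniq; first by case: Ws => _; apply.
  move=> z Wz; rewrite opprD addrACA -scalerBr linearDl /= dotpZl.
  by rewrite !pO// mulr0 addr0.
have pOE x z : W z -> dotp x z = dotp (p x) z.
  by move=> Wz; apply: subr0_eq; rewrite -dotpBl pO.
have pb : bop p.
  split=> //; exists 1 => x; rewrite mul1r.
  have [->|px0] := eqVneq (p x) 0; first by rewrite normr0.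
  have npx0 : 0 < `|p x| by rewrite normr_gt0.
  rewrite -(ler_pM2r npx0) -expr2 -dotpp_norm -pOE//.
  rewrite (le_trans _ (cauchy_schwarz _ _))//.
  by rewrite pOE// [leRHS]ger0_norm// dotp_ge0.
have psa : adjoint p p.
  by move=> x y; rewrite (pOE x)// dotpC (pOE y)// -dotpC.
have pid : p \o p = p by apply/funext => x /=; rewrite pfix.
by exists (Projector pb pid psa).
Qed.

Lemma bop0 H K (f : H -> K) : bop f -> f 0 = 0.
Proof.
by move=> [fl _]; have := fl (-1) 0 0; rewrite scaler0 addr0 scaleN1r addNr.
Qed.

Lemma bopZ H K (f : H -> K) (k : R[i]) x : bop f -> f (k *: x) = k *: f x.
Proof.
by move=> bf; have [fl _] := bf; have := fl k x 0; rewrite (bop0 bf) !addr0.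
Qed.

Lemma bopD H K (f : H -> K) x y : bop f -> f (x + y) = f x + f y.
Proof. by move=> [fl _]; have := fl 1 x y; rewrite !scale1r. Qed.

Lemma bopB H K (f : H -> K) x y : bop f -> f (x - y) = f x - f y.
Proof. by move=> bf; rewrite bopD// -scaleN1r bopZ// scaleN1r. Qed.

Lemma bop_sum H K (f : H -> K) (I : Type) (r : seq I) (P : pred I)
    (F : I -> H) :
  bop f -> f (\sum_(i <- r | P i) F i) = \sum_(i <- r | P i) f (F i).
Proof.
move=> bf; apply: (big_morph f) => [x y|]; first exact: bopD.
exact: bop0.
Qed.

Lemma bop_bound H K (f : H -> K) : bop f ->
  exists2 M : R, 0 < M & forall x, `|f x| <= M%:C * `|x|.
Proof.
move=> [fl [M fM]].
have /gt0_complexP[N N0 NE] : 0 < `|M| + 1 by rewrite ltr_wpDl.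
exists N => // x; rewrite -NE mulrDl mul1r.
have := le_trans (normr_ge0 _) (fM x) => /ger0_norm Mx.
by rewrite (le_trans (fM x))// -Mx normrM normr_id lerDl.
Qed.

Lemma dotp_normalize H (x : H) :
  x != 0 -> dotp (`|x|^-1 *: x) (`|x|^-1 *: x) = 1.
Proof.
move=> x0; rewrite dnormZ dotpp_norm normfV normr_id -exprMn mulVf ?expr1n//.
by rewrite normr_eq0.
Qed.

Lemma quad_normalize_ge0 H (c : H -> H) x : bop c -> x != 0 ->
  (0 <= dotp (c (`|x|^-1 *: x)) (`|x|^-1 *: x)) = (0 <= dotp (c x) x).
Proof.
move=> bc x0; rewrite bopZ// dotpZl dotpZr mulrA -normCK pmulr_rge0//.
by rewrite exprn_gt0// normfV normr_id invr_gt0 normr_gt0.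
Qed.

Lemma adjointC H K (f : H -> K) g : adjoint f g -> adjoint g f.
Proof. by move=> fg x y; rewrite dotpC -fg -dotpC. Qed.

Lemma adjoint_uniq H K (f : H -> K) g g' : adjoint f g -> adjoint f g' -> g = g'.
Proof.
by move=> fg fg'; apply/funext => y; apply: dotp_extr => x; rewrite -fg -fg'.
Qed.

Lemma adjoint_bop H K (f : H -> K) g : bop f -> adjoint f g -> bop g.
Proof.
move=> bf fg; split.
  move=> k x y; apply: dotp_extr => z.
  by rewrite -fg dotpDr dotpZr !fg dotpDr dotpZr.
have [M M0 fM] := bop_bound bf; exists M%:C => y.
have [->|gy0] := eqVneq (g y) 0; first by rewrite normr0 mulr_ge0// ler0c ltW.
have ngy0 : 0 < `|g y| by rewrite normr_gt0.
rewrite -(ler_pM2r ngy0) -expr2 -dotpp_norm -fg -[leLHS]ger0_norm; last first.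
  by rewrite fg dotp_ge0.
rewrite (le_trans (cauchy_schwarz _ _))// (le_trans (ler_wpM2r _ (fM _)))//.
by rewrite mulrAC.
Qed.

(** Riesz representation of the functional sending [x] to [dotp (f x) y]: a vector [u] orthogonal to
    its kernel [W], suitably scaled, represents it. *)
Lemma ex_adjoint H K (f : H -> K) : bop f -> exists2 g, bop g & adjoint f g.
Proof.
move=> bf; suff /choice[g fg] : forall y, exists z, forall x,
    dotp (f x) y = dotp x z.
  have afg : adjoint f g by move=> x y; exact: fg.
  by exists g => //; exact: adjoint_bop afg.
move=> y; pose W := [set x | dotp (f x) y = 0].
have Ws : subspace W.
  split; first by rewrite /W /= (bop0 bf) dotp0l.
  move=> k a b; rewrite /W /= => fa fb.
  by rewrite bopD// bopZ// dotpDl dotpZl fa fb mulr0 addr0.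
have [M M0 fM] := bop_bound bf.
have Wc : hclosed W.
  move=> x clx; apply/eqP; rewrite -normr_le0.
  apply/ler_addgt0Pl => e e0; rewrite addr0.
  have M0' : 0 < M%:C by rewrite ltcR.
  have c0 : 0 < M%:C * (`|y| + 1) by rewrite mulr_gt0// ltr_wpDl.
  have [z Wz xz] := clx _ (divr_gt0 e0 c0).
  have -> : dotp (f x) y = dotp (f (x - z)) y by rewrite bopB// dotpBl Wz subr0.
  rewrite (le_trans (cauchy_schwarz _ _))//.
  rewrite (le_trans (ler_wpM2r (normr_ge0 y) (fM _)))//.
  rewrite mulrAC; move: xz; rewrite ler_pdivlMr// mulrC; apply: le_trans.
  by rewrite ler_wpM2r// ler_wpM2l ?(ltW M0')// lerDl.
have [W1|] := pselect (forall x, W x); first by exists 0 => x; rewrite dotp0r W1.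
move=> /existsNP[x0 nx0].
have [p [pW pfix]] := projector_onto Ws Wc.
pose u := x0 - p x0.
have fu : dotp (f u) y != 0.
  by rewrite bopB// dotpBl pW subr0; exact/eqP.
have uO x : W x -> dotp x u = 0.
  by move=> Wx; rewrite /u dotpBr -(proj_sadj p) pfix// subrr.
have uu : dotp u u != 0.
  by apply: contra_neq fu => /dotp_eq0 ->; rewrite bop0// dotp0l.
exists (Num.conj (dotp (f u) y / dotp u u) *: u) => x.
rewrite dotpZr conjCK; set c := dotp (f u) y.
have : W (x - (dotp (f x) y / c) *: u).
  by rewrite /W /= bopB// bopZ// dotpBl dotpZl divfK// subrr.
move=> /uO; rewrite dotpBl dotpZl => /eqP; rewrite subr_eq0 => /eqP ->.
by rewrite mulrA mulrAC divfK// [RHS]mulrC divfK.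
Qed.

End Hilbert.

(** * Algebras of operators and their representations *)

Section Algebras.
Context {R : realType}.
Implicit Types H K L : hilbertType R.

Lemma bop_id H : bop (idfun : H -> H).
Proof. by split=> //; exists 1 => x; rewrite mul1r. Qed.

Lemma bop_comp H K L (f : H -> K) (g : K -> L) : bop f -> bop g -> bop (g \o f).
Proof.
move=> bf bg; split; first by move=> k x y /=; rewrite bopD// bopZ// bopD// bopZ.
have [M M0 fM] := bop_bound bf; have [N N0 gN] := bop_bound bg.
exists (N%:C * M%:C) => x /=; rewrite (le_trans (gN _))// -mulrA.
by rewrite ler_wpM2l// ler0c ltW.
Qed.

Lemma bop_subspace H K : subspace (bop : set (H -> K)).
Proof.
split.
  split; first by move=> k x y; rewrite scaler0 addr0.
  by exists 0 => x; rewrite normr0 mul0r.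
move=> k f g bf bg; split.
  move=> l x y.
  change (k *: f (l *: x + y) + g (l *: x + y)
    = l *: (k *: f x + g x) + (k *: f y + g y)).
  rewrite (bopD _ _ bf) (bopD _ _ bg) (bopZ _ _ bf) (bopZ _ _ bg).
  by rewrite (scalerDr k) (scalerDr l) addrACA !scalerA (mulrC k).
have [M M0 fM] := bop_bound bf; have [N N0 gN] := bop_bound bg.
exists (`|k| * M%:C + N%:C) => x.
rewrite (le_trans (ler_normD _ _))// mulrDl lerD// normrZ -mulrA.
by rewrite ler_wpM2l.
Qed.

Lemma bop_cstar H : cstar_subalgebra (bop : set (H -> H)).
Proof.
split=> //.
- exact: bop_subspace.
- by move=> a b ba bb; exact: bop_comp.
- by move=> a a'; exact: adjoint_bop.
- by move=> f [].
Qed.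

Lemma cstar_gen_cstar H (X : set (H -> H)) :
  X `<=` bop -> cstar_subalgebra (cstar_gen X).
Proof.
move=> Xb; split.
- by apply: smallest_sub => //; exact: bop_cstar.
- split; first by move=> A [[_ [A0 _] _ _ _] _].
  move=> k x y Ax Ay A AX; case: (AX) => -[_ [_ AP] _ _ _] _.
  by apply: AP; [exact: Ax|exact: Ay].
- move=> a b Aa Ab A AX; case: (AX) => -[_ _ AM _ _] _.
  by apply: AM; [exact: Aa|exact: Ab].
- move=> a a' Aa aa' A AX; case: (AX) => -[_ _ _ As _] _.
  by apply: As aa'; exact: Aa.
- move=> f [bf fA] A AX; case: (AX) => -[_ _ _ _ Ac] _.
  by apply: Ac; split=> // e /fA[g Ag fg]; exists g => //; exact: Ag.
Qed.

Lemma adjoint_id H : adjoint (idfun : H -> H) idfun.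
Proof. by []. Qed.

Lemma adjoint_comp H K L (f : H -> K) f' (g : K -> L) g' :
  adjoint f f' -> adjoint g g' -> adjoint (g \o f) (f' \o g').
Proof. by move=> ff gg x y /=; rewrite gg ff. Qed.

Lemma adjoint_lin H K (k : R[i]) (f g : H -> K) f' g' :
  adjoint f f' -> adjoint g g' ->
  adjoint (k *: f + g) (Num.conj k *: f' + g').
Proof.
move=> ff gg x y.
change (dotp (k *: f x + g x) y = dotp x (Num.conj k *: f' y + g' y)).
by rewrite dotpDl dotpZl dotpDr dotpZr conjCK ff gg.
Qed.

Lemma form_closure H n (s : 'I_n -> 'I_n -> H -> H) (V : set H) :
  (forall i j, bop (s i j)) ->
  (forall y : 'I_n -> H, (forall i, V (y i)) ->
     0 <= \sum_(i < n) \sum_(j < n) dotp (s i j (y j)) (y i)) ->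
  forall x : 'I_n -> H, (forall i, hclosure V (x i)) ->
     0 <= \sum_(i < n) \sum_(j < n) dotp (s i j (x j)) (x i).
Proof.
move=> bs posV x Vx; apply: ge0_approx => e e0.
have /choice[M Mb] : forall ij, exists M : R, 0 < M /\
    forall x, `|s ij.1 ij.2 x| <= M%:C * `|x|.
  by move=> [i j]; have [M M0 sM] := bop_bound (bs i j); exists M.
have M0 i j : 0 <= (M (i, j))%:C by rewrite ler0c; apply: ltW; case: (Mb (i, j)).
pose C := \sum_(i < n) \sum_(j < n) (M (i, j))%:C * (`|x i| + `|x j| + 1).
have C0 : 0 <= C.
  apply: sumr_ge0 => i _; apply: sumr_ge0 => j _.
  by rewrite mulr_ge0// !addr_ge0.
(* Chosen so that [C * d <= e], and [d <= 1], which keeps the norm of [y j] below that of [x j] plus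
   1. *)
pose d := e / (C + 1 + e).
have D0 : 0 < C + 1 + e by rewrite addr_gt0// ltr_wpDl.
have d0 : 0 < d by rewrite divr_gt0.
have d1 : d <= 1 by rewrite /d ler_pdivrMr// mul1r lerDr addr_ge0.
have dC : C * d <= e.
  rewrite mulrCA ler_piMr ?(ltW e0)// ler_pdivrMr// mul1r -addrA lerDl.
  by rewrite addr_ge0// ltW.
have /choice[y yP] : forall i, exists y, V y /\ `|x i - y| <= d.
  by move=> i; have [y] := Vx i _ d0; exists y.
exists (\sum_(i < n) \sum_(j < n) dotp (s i j (y j)) (y i)).
  by apply: posV => i; case: (yP i).
rewrite (le_trans _ dC)// -sumrB mulr_suml (le_trans (ler_norm_sum _ _ _))//.
apply: ler_sum => i _; rewrite -sumrB mulr_suml (le_trans (ler_norm_sum _ _ _))//.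
apply: ler_sum => j _.
have [_ xyi] := yP i; have [_ xyj] := yP j; have [_ sM] := Mb (i, j).
have -> : dotp (s i j (x j)) (x i) - dotp (s i j (y j)) (y i)
    = dotp (s i j (x j - y j)) (x i) + dotp (s i j (y j)) (x i - y i).
  by rewrite bopB// dotpBl dotpBr addrA subrK.
rewrite (le_trans (ler_normD _ _))// -addrA mulrDr mulrDl lerD//.
  rewrite (le_trans (cauchy_schwarz _ _))// mulrAC ler_wpM2r//.
  by rewrite (le_trans (sM _))//= ler_wpM2l.
rewrite (le_trans (cauchy_schwarz _ _))// ler_pM// (le_trans (sM _))//=.
rewrite ler_wpM2l// -{1}(subrK (x j) (y j)) addrC (le_trans (ler_normD _ _))//.
by rewrite lerD// distrC (le_trans xyj).
Qed.

Lemma quad_closure H (c : H -> H) (V : set H) x : bop c -> hclosure V x ->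
  (forall y, V y -> 0 <= dotp (c y) y) -> 0 <= dotp (c x) x.
Proof.
move=> bc Vx posV.
have := @form_closure H 1 (fun _ _ => c) V (fun _ _ => bc) _
  (fun _ => x) (fun _ => Vx).
rewrite !big_ord1; apply => y Vy.
by rewrite !big_ord1; apply: posV.
Qed.

(** Invariance of [W] under the adjoint [a'] gives invariance of the orthogonal complement under
    [a], so [a] is block diagonal for [p]. *)
Lemma invariant_comm H (W : set H) (p : projector H) a a' : 
  (forall x, W (p x)) -> (forall x, W x -> p x = x) -> bop a ->
  adjoint a a' -> (forall x, W x -> W (a x)) -> (forall x, W x -> W (a' x)) ->
  a \o p = p \o a.
Proof.
move=> pW pfix ba aa' aW a'W; apply/funext => x /=.
have bp := proj_bop p.
have /eqP : p (a (x - p x)) = 0.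
  apply: dotp_extl => z; rewrite dotp0l (proj_sadj p) aa'.
  rewrite -[a' (p z)](pfix _ (a'W _ (pW z))) -(proj_sadj p).
  by rewrite bopB// (pfix (p x))// subrr dotp0l.
rewrite bopB// bopB// subr_eq0 => /eqP ->.
by rewrite [RHS]pfix//; exact/aW/pW.
Qed.

Lemma hclosure_invariant H (A B : set H) a : bop a ->
  (forall x, A x -> B (a x)) -> forall x, hclosure A x -> hclosure B (a x).
Proof.
move=> ba aAB x Ax e e0; have [M M0 aM] := bop_bound ba.
have M0' : 0 < M%:C by rewrite ltcR.
have [y Ay xy] := Ax _ (divr_gt0 e0 M0').
exists (a y); first exact: aAB.
rewrite -bopB// (le_trans (aM _))// mulrC -ler_pdivlMr//.
Qed.

Lemma projector_hclosed H (p : projector H) : hclosed [set x | p x = x].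
Proof.
move=> x px; have bq := projC_bop p.
apply/eqP; rewrite eq_sym -subr_eq0 -normr_le0.
have := hclosure_invariant bq (B := [set 0]) _ px.
move=> /(_ _)/(_ _) h; apply/ler_addgt0Pl => e e0; rewrite addr0.
have [|_ -> ] := h _ e e0; first by move=> y /= ->; rewrite subrr.
by rewrite subr0.
Qed.

End Algebras.

(** * Unital representations and reduction of matrix positivity to single elements *)

Section Representations.
Context {R : realType}.
Implicit Types H K L : hilbertType R.

Definition unital_rep H L (A : set (H -> H)) (pi : (H -> H) -> (L -> L)) :=
  [/\ cstar_subalgebra A, A idfun, star_morphism A pi & pi idfun = idfun].

Definition commutes_with H L (A : set (H -> H)) (pi : (H -> H) -> (L -> L))
    (p : L -> L) := forall a, A a -> pi a \o p = p \o pi a.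

Section Rep.
Context H L (A : set (H -> H)) (pi : (H -> H) -> (L -> L)).
Hypothesis piA : unital_rep A pi.

Lemma rep_bop a : A a -> bop (pi a).
Proof. by case: piA => _ _ [pb _ _ _] _; exact: pb. Qed.

Lemma rep_lin k a b x : A a -> A b -> pi (k *: a + b) x = k *: pi a x + pi b x.
Proof. by case: piA => _ _ [_ pl _ _] _ Aa Ab; rewrite pl. Qed.

Lemma rep_comp a b x : A a -> A b -> pi (a \o b) x = pi a (pi b x).
Proof. by case: piA => _ _ [_ _ pm _] _ Aa Ab; rewrite pm. Qed.

Lemma rep_id x : pi idfun x = x.
Proof. by case: piA => _ _ _ ->. Qed.

Lemma rep_adjoint a a' : A a -> adjoint a a' -> adjoint (pi a) (pi a').
Proof. by case: piA => _ _ [_ _ _ ps] _; exact: ps. Qed.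

Lemma commutes_withE (p : L -> L) a x : commutes_with A pi p -> A a ->
  pi a (p x) = p (pi a x).
Proof. by move=> pc /pc/(congr1 (fun f => f x)). Qed.

Lemma alg_subspace : subspace A.
Proof. by case: piA => -[]. Qed.

Lemma alg_comp a b : A a -> A b -> A (a \o b).
Proof. by case: piA => -[_ _ AM _ _] _ _ _; exact: AM. Qed.

Lemma alg_adjoint a : A a -> exists2 a', A a' & adjoint a a'.
Proof.
case: piA => -[Ab _ _ As _] _ _ _ Aa.
by have [a' _ aa'] := ex_adjoint (Ab _ Aa); exists a' => //; exact: As aa'.
Qed.

Lemma rep0 x : pi 0 x = 0.
Proof.
have [A0 _] := alg_subspace.
by have := rep_lin (-1) x A0 A0; rewrite scaler0 addr0 scaleN1r addNr.
Qed.

Lemma rep_sum (I : Type) (r : seq I) (P : pred I) (F : I -> H -> H) x :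
  (forall i, P i -> A (F i)) ->
  pi (\sum_(i <- r | P i) F i) x = \sum_(i <- r | P i) pi (F i) x.
Proof.
move=> AF; have As := alg_subspace.
suff : A (\sum_(i <- r | P i) F i) /\
  pi (\sum_(i <- r | P i) F i) x = \sum_(i <- r | P i) pi (F i) x by case.
apply: (big_rec2 (fun (a : H -> H) y => A a /\ pi a x = y)).
  by split; [case: As|exact: rep0].
move=> i y a /AF AFi [Aa <-]; split; first exact: subspaceD.
by have := rep_lin 1 x AFi Aa; rewrite !scale1r.
Qed.

(** The cyclic subspace generated by [v]. *)
Definition orbit_closure (v : L) := hclosure [set w | exists2 a, A a & w = pi a v].

Lemma orbit_closure_subspace v : subspace (orbit_closure v).
Proof.
have As := alg_subspace; apply: hclosure_subspace; split.
  by exists 0; [case: As|rewrite rep0].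
move=> k _ _ [a Aa ->] [b Ab ->]; exists (k *: a + b); last by rewrite rep_lin.
by case: As => _; exact.
Qed.

Lemma orbit_closure_id v : orbit_closure v v.
Proof.
by apply: hclosure_sub; exists idfun; [case: piA|rewrite rep_id].
Qed.

Lemma orbit_closure_rep a v x : A a -> orbit_closure v x -> orbit_closure v (pi a x).
Proof.
move=> Aa; apply: hclosure_invariant; first exact: rep_bop.
by move=> _ [b Ab ->]; exists (a \o b); [exact: alg_comp|rewrite rep_comp].
Qed.

Lemma invariant_commutes (W : set L) (p : projector L) :
  (forall x, W (p x)) -> (forall x, W x -> p x = x) ->
  (forall a, A a -> forall x, W x -> W (pi a x)) -> commutes_with A pi p.
Proof.
move=> pW pfix piW a Aa; have [a' Aa' aa'] := alg_adjoint Aa.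
apply: (invariant_comm pW pfix (rep_bop Aa) (rep_adjoint Aa aa')).
  exact: piW.
exact: piW.
Qed.

(* Gram-Schmidt: peeling off the orbit closures of x_(n-1), ..., x_0 one at a
   time splits x orthogonally into tuples lying in a single orbit closure. *)
Lemma cyclic_form_ge0 n (s : 'I_n -> 'I_n -> H -> H) (p : projector L) :
  (forall i j, A (s i j)) -> commutes_with A pi p ->
  (forall v, p v = v -> forall b : 'I_n -> H -> H, (forall i, A (b i)) ->
    0 <= \sum_(i < n) \sum_(j < n)
           dotp (pi (s i j) (pi (b j) v)) (pi (b i) v)) ->
  forall x : 'I_n -> L, (forall i, p (x i) = x i) ->
    0 <= \sum_(i < n) \sum_(j < n) dotp (pi (s i j) (x j)) (x i).
Proof.
move=> As pcomm cyc.
(* Induction on the number [k] of leading entries that may be nonzero. *)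
suff claim k (x : 'I_n -> L) : (k <= n)%N -> (forall i, p (x i) = x i) ->
    (forall i : 'I_n, (k <= i)%N -> x i = 0) ->
    0 <= \sum_(i < n) \sum_(j < n) dotp (pi (s i j) (x j)) (x i).
  move=> x px; apply: (claim n) => // i.
  by rewrite leqNgt ltn_ord.
elim: k x => [|k IH] x kn px xk.
  apply: sumr_ge0 => i _; apply: sumr_ge0 => j _.
  by rewrite [x i]xk// dotp0r.
pose v := x (Ordinal kn); pose W := orbit_closure v.
have Wc : hclosed W by exact: hclosure_closed.
have [P [PW Pfix]] := projector_onto (orbit_closure_subspace v) Wc.
have bP := proj_bop P; have bp := proj_bop p.
have Pcomm : commutes_with A pi P.
  by apply: (invariant_commutes PW Pfix) => a Aa y; exact: orbit_closure_rep.
have pv : p v = v by exact: px.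
have Wp y : W y -> p y = y.
  move=> Wy; apply: projector_hclosed; apply: hclosure_min Wy; last first.
    exact: hclosure_closed.
  move=> _ [a Aa ->]; apply: hclosure_sub => /=.
  by rewrite -(commutes_withE _ pcomm)// pv.
(* [P] commutes with the representation, so the cross terms vanish. *)
have split1 i j : dotp (pi (s i j) (x j)) (x i) =
    dotp (pi (s i j) (P (x j))) (P (x i)) +
    dotp (pi (s i j) (x j - P (x j))) (x i - P (x i)).
  have cE y : pi (s i j) (P y) = P (pi (s i j) y).
    exact: commutes_withE.
  have PP y : P (P y) = P y by rewrite Pfix.
  rewrite bopB; last exact: rep_bop.
  rewrite dotpBl !dotpBr !cE !(proj_sadj P) !PP.
  by rewrite subrr subr0 addrC subrK.
under eq_bigr do under eq_bigr do rewrite split1.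
under eq_bigr do rewrite big_split; rewrite big_split /=.
apply: addr_ge0.
  have F := @form_closure R L n (fun i j => pi (s i j))
    [set w | exists2 a, A a & w = pi a v].
  apply: (F _ _ (fun i => P (x i))).
  - by move=> i j; exact: rep_bop.
  - move=> y yV; have /choice[b bP'] : forall i, exists a, A a /\ y i = pi a v.
      by move=> i; have [a] := yV i; exists a.
    have -> : y = fun i => pi (b i) v by apply/funext => i; case: (bP' i).
    by apply: cyc => // i; case: (bP' i).
  - by move=> i; exact: PW.
(* In the remainder entry [k] vanishes as well, because [v] lies in its own cyclic subspace. *)
apply: (IH (fun i => x i - P (x i))) => [|i|i ki]; first exact: ltnW.
  by rewrite bopB// px (Wp (P (x i)))//; exact: PW.
have [ik|] := leqP k.+1 i; first by rewrite xk// (bop0 bP) subrr.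
rewrite ltnS => ik; have -> : i = Ordinal kn by apply/val_inj/eqP; rewrite eqn_leq ik.
by rewrite -/v Pfix ?subrr//; exact: orbit_closure_id.
Qed.

(** Moving each [b i] across the inner product as [b' i] turns the form at a tuple from the orbit of
    [v] into one element [c] of [A] tested at [v]. *)
Lemma quad_form n (s : 'I_n -> 'I_n -> H -> H) (b b' : 'I_n -> H -> H) v :
  (forall i j, A (s i j)) -> (forall i, A (b i)) -> (forall i, A (b' i)) ->
  (forall i, adjoint (b i) (b' i)) ->
  let c := \sum_(i < n) \sum_(j < n) (b' i \o (s i j \o b j)) in
  A c /\ dotp (pi c v) v = \sum_(i < n) \sum_(j < n)
           dotp (pi (s i j) (pi (b j) v)) (pi (b i) v).
Proof.
move=> As Ab Ab' bb' c; have sA := alg_subspace.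
have Acij i j : A (b' i \o (s i j \o b j)) by apply: alg_comp => //; exact: alg_comp.
have Aci i : A (\sum_(j < n) (b' i \o (s i j \o b j))) by exact: subspace_sum.
split; first exact: subspace_sum.
rewrite rep_sum// dotp_suml; apply: eq_bigr => i _.
rewrite rep_sum// dotp_suml; apply: eq_bigr => j _.
rewrite rep_comp//; last exact: alg_comp.
by rewrite rep_comp// -(rep_adjoint (Ab' i) (adjointC (bb' i))).
Qed.

Definition pos_on (p : L -> L) (c : H -> H) :=
  forall v, p v = v -> 0 <= dotp (pi c v) v.

Definition form_pos_on (p : L -> L) n (s : 'I_n -> 'I_n -> H -> H) :=
  forall x : 'I_n -> L, (forall i, p (x i) = x i) ->
    0 <= \sum_(i < n) \sum_(j < n) dotp (pi (s i j) (x j)) (x i).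

End Rep.

(** By [cyclic_form_ge0] it is enough to test tuples in the orbit of one vector, and there
    [quad_form] turns the matrix into a single element of [A], to which the hypothesis applies. *)
Lemma pos_on_form H L (M : hilbertType R) (A : set (H -> H))
    (pi : (H -> H) -> (L -> L)) (tau : (H -> H) -> (M -> M))
    (p : projector L) (q : projector M) :
  unital_rep A pi -> unital_rep A tau -> commutes_with A pi p ->
  commutes_with A tau q ->
  (forall c, A c -> pos_on pi p c -> pos_on tau q c) ->
  forall n (s : 'I_n -> 'I_n -> H -> H), (forall i j, A (s i j)) ->
    form_pos_on pi p s -> form_pos_on tau q s.
Proof.
move=> piA tauA pc qc pq n s As ps.
apply: (cyclic_form_ge0 tauA As qc) => v qv b Ab.
have /choice[b' b'P] : forall i, exists b', A b' /\ adjoint (b i) b'.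
  by move=> i; have [b' Ab' bb'] := alg_adjoint piA (Ab i); exists b'.
have Ab' i : A (b' i) by case: (b'P i).
have bb' i : adjoint (b i) (b' i) by case: (b'P i).
have [Ac <-] := quad_form tauA v As Ab Ab' bb'.
apply: pq => // w pw.
have [_ ->] := quad_form piA w As Ab Ab' bb'.
by apply: ps => i; rewrite -(commutes_withE _ pc (Ab i)) pw.
Qed.

Lemma id_rep H (A : set (H -> H)) :
  cstar_subalgebra A -> A idfun -> unital_rep A id.
Proof. by move=> cA A1; split=> //; split=> //; case: cA. Qed.

Lemma proj_id_idem H : (idfun : H -> H) \o idfun = idfun.
Proof. by []. Qed.

Definition proj_id H : projector H :=
  Projector (@bop_id R H) (@proj_id_idem H) (@adjoint_id R H).

Lemma dense_hclosure H (V : set H) x : dense V -> hclosure V x.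
Proof.
move=> dV e e0; have [|y []] := dV (ball x e) _ (ball_open x e).
  by exists x; exact: ballxx.
by rewrite -ball_normE => /ltW xy Vy; exists y.
Qed.

Lemma lspan_subspace (V : lmodType R[i]) (X : set V) : subspace (lspan X).
Proof.
split; first by move=> A [[]].
move=> k x y Ax Ay A AX; case: (AX) => -[_ AP] _.
by apply: AP; [exact: Ax|exact: Ay].
Qed.

Lemma sub_lspan (V : lmodType R[i]) (X : set V) : X `<=` lspan X.
Proof. by move=> x Xx A [_]; exact. Qed.

(** * The universal representation: sums of GNS spaces and positivity *)

Section Universal.
Context K (U : hilbertType R) (A : set (K -> K)) (rho : (K -> K) -> (U -> U))
  (xi : ((K -> K) -> R[i]) -> U).
Hypotheses (cA : cstar_subalgebra A) (A1 : A idfun).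
Hypothesis rhoA : star_morphism A rho.
Hypothesis xi_state : forall f, is_state A f ->
  forall a, A a -> dotp (rho a (xi f)) (xi f) = f a.
Hypothesis xi_eq : forall f g, is_state A f -> is_state A g ->
  {in A, f =1 g} -> xi f = xi g.
Hypothesis xi_orth : forall f g, is_state A f -> is_state A g ->
  ~ {in A, f =1 g} ->
  forall a b, A a -> A b -> dotp (rho a (xi f)) (rho b (xi g)) = 0.
Hypothesis xi_dense : dense (lspan [set v | exists f a,
  [/\ is_state A f, A a & v = rho a (xi f)]]).

(** The Hilbert sum of the GNS spaces of the states in [F]. *)
Definition state_span (F : set ((K -> K) -> R[i])) : set U :=
  hclosure (lspan [set v | exists f a,
    [/\ is_state A f /\ F f, A a & v = rho a (xi f)]]).

Lemma state_span_setT x : state_span setT x.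
Proof.
have := dense_hclosure x xi_dense.
suff -> : [set v | exists f a, [/\ is_state A f, A a & v = rho a (xi f)]] =
  [set v | exists f a, [/\ is_state A f /\ setT f, A a & v = rho a (xi f)]] by [].
by apply/seteqP; split=> v [f [a []]]; [|case]; exists f, a.
Qed.

(** [rho idfun] fixes all vectors [rho a (xi f)], by multiplicativity, and these span a dense
    subspace. *)
Lemma universal_unital : unital_rep A rho.
Proof.
split=> //; apply/funext => x; have [rb rl rm rs] := rhoA.
pose W := [set y | rho idfun y - y = 0].
apply/subr0_eq; change (W x).
suff WU : hclosure (lspan [set v | exists f a,
    [/\ is_state A f /\ setT f, A a & v = rho a (xi f)]]) `<=` W.
  by apply: WU; exact: state_span_setT.
have bd : bop (fun y => rho idfun y - y).
  have -> : (fun y => rho idfun y - y) = (-1) *: idfun + rho idfun.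
    by apply/funext => y; rewrite addrC -[in LHS]scaleN1r.
  by case: (bop_subspace U U) => _; apply; [exact: bop_id|exact: rb].
apply: hclosure_min; last first.
  move=> y /(hclosure_invariant (B := [set 0]) bd)/(_ _) h.
  apply/eqP; rewrite -normr_le0; apply/ler_addgt0Pl => e e0; rewrite addr0.
  by have [|z ->] := h _ e e0; [move=> z|rewrite subr0].
apply: smallest_sub.
  split; first by rewrite /W /= subr0 bop0//; exact: rb.
  move=> k y z; rewrite /W /= => Wy Wz.
  have [bl _] := bd; have := bl k y z; rewrite Wy Wz scaler0 addr0; exact.
move=> _ [f [a [_ Aa ->]]]; rewrite /W /=.
by have /(congr1 (fun g => g (xi f))) /= <- := rm _ _ A1 Aa; rewrite subrr.
Qed.

Let rU := universal_unital.

(** The GNS spaces are invariant and mutually orthogonal, so the form of [rho c] on a finite sum is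
    the sum of the forms on the summands. *)
Lemma state_span_pos (F : set ((K -> K) -> R[i])) c : A c ->
  (forall f a, is_state A f -> F f -> A a ->
     0 <= dotp (rho c (rho a (xi f))) (rho a (xi f))) ->
  forall x, state_span F x -> 0 <= dotp (rho c x) x.
Proof.
move=> Ac cpos x Fx; apply: (quad_closure (rep_bop rU Ac) Fx) => {x Fx}.
(* Finite sums are indexed by distinct cyclic vectors [e] and not by states, since states that agree
   on [A] share their vector. *)
pose X (e : U) := exists2 f, is_state A f /\ F f & e = xi f.
pose Z := [set x : U | exists (l : seq U) (a : U -> K -> K),
  [/\ uniq l, forall e, e \in l -> X e, forall e, A (a e)
    & x = \sum_(e <- l) rho (a e) e]].
have sA := alg_subspace rU; have [A0 _] := sA.
(* Padding with zero coefficients brings two sums to a common index list. *)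
have Zext (l l' : seq U) (a : U -> K -> K) : uniq l -> uniq l' ->
    {subset l <= l'} -> \sum_(e <- l) rho (a e) e =
    \sum_(e <- l') rho (if e \in l then a e else 0) e.
  move=> ul ul' ll'; rewrite [RHS](bigID (mem l)) /= [X in _ + X]big1 ?addr0.
    rewrite -[RHS]big_filter [RHS](perm_big l); last first.
      apply: uniq_perm => //; first exact: filter_uniq.
      by move=> e; rewrite mem_filter andb_idr//; exact: ll'.
    by apply: eq_big_seq => e ->.
  by move=> e /negbTE ->; rewrite (rep0 rU).
suff ZV x : lspan [set v | exists f a,
    [/\ is_state A f /\ F f, A a & v = rho a (xi f)]] x -> Z x.
  move=> x /ZV[l [a [ul Xl Aa ->]]].
  rewrite (bop_sum _ _ _ (rep_bop rU Ac)).
  rewrite dotp_suml big_seq; apply: sumr_ge0 => e el.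
  rewrite dotp_sumr (bigD1_seq e)//= [X in _ + X]big1_seq ?addr0.
    by have [f [fs Ff] ->] := Xl _ el; apply: cpos.
  move=> e' /andP[e'e e'l]; rewrite -(rep_comp rU)//.
  have [f [fs Ff] fE] := Xl _ el; have [g [gs Fg] gE] := Xl _ e'l.
  have := xi_orth fs gs _ (alg_comp rU Ac (Aa e)) (Aa e').
  rewrite -fE -gE; apply=> fg; case/negP: e'e.
  by rewrite gE -(xi_eq fs gs fg) -fE.
apply: smallest_sub => {x}; last first.
  move=> _ [f [a [[fs Ff] Aa ->]]]; exists [:: xi f], (fun=> a).
  by split=> // [e|]; rewrite ?big_seq1// inE => /eqP ->; exists f.
split; first by exists [::], (fun=> 0); split=> //; rewrite big_nil.
move=> k _ _ [l [a [ul Xl Aa ->]]] [m [b [um Xm Ab ->]]].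
pose a' e := if e \in l then a e else 0; pose b' e := if e \in m then b e else 0.
have Aa' e : A (a' e) by rewrite /a'; case: ifP.
have Ab' e : A (b' e) by rewrite /b'; case: ifP.
exists (undup (l ++ m)), (fun e => k *: a' e + b' e); split.
- exact: undup_uniq.
- by move=> e; rewrite mem_undup mem_cat => /orP[/Xl|/Xm].
- by move=> e; case: sA => _; apply.
- rewrite (Zext l (undup (l ++ m)))// ?undup_uniq//; last first.
    by move=> e el; rewrite mem_undup mem_cat el.
  rewrite (Zext m (undup (l ++ m)))// ?undup_uniq//; last first.
    by move=> e em; rewrite mem_undup mem_cat em orbT.
  rewrite scaler_sumr -big_split /=; apply: eq_bigr => e _.
  by rewrite (rep_lin rU).
Qed.

(** At [rho a (xi f)] the form of [rho c] is the value of the state [f] at [a' \o (c \o a)], again a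
    positive operator. *)
Lemma universal_pos c : A c -> (forall x, 0 <= dotp (c x) x) ->
  forall x, 0 <= dotp (rho c x) x.
Proof.
move=> Ac cpos x; apply: (state_span_pos (F := setT)) => //; last first.
  exact: state_span_setT.
move=> f a fs _ Aa; have [a' Aa' aa'] := alg_adjoint rU Aa.
have Ad : A (a' \o (c \o a)) by apply: (alg_comp rU) => //; exact: (alg_comp rU).
have -> : dotp (rho c (rho a (xi f))) (rho a (xi f))
    = dotp (rho (a' \o (c \o a)) (xi f)) (xi f).
  rewrite (rep_comp rU)//; last exact: (alg_comp rU).
  by rewrite (rep_comp rU)// -(rep_adjoint rU Aa' (adjointC aa')).
rewrite xi_state//; have [_ fpos _] := fs; apply: fpos => // y /=.
by rewrite (adjointC aa').
Qed.

Lemma vector_state v : dotp v v = 1 -> is_state A (fun a => dotp (rho a v) v).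
Proof.
move=> v1; split.
- by move=> k a b Aa Ab; rewrite (rep_lin rU)// dotpDl dotpZl.
- by move=> a Aa apos; exact: universal_pos.
- by rewrite (rep_id rU).
Qed.

Lemma vector_state_id v : dotp v v = 1 -> is_state A (fun a => dotp (a v) v).
Proof.
move=> v1; split=> //.
move=> k a b Aa Ab.
change (dotp (k *: a v + b v) v = k * dotp (a v) v + dotp (b v) v).
by rewrite dotpDl dotpZl.
Qed.

End Universal.
End Representations.

(** * The Hilbert hotel *)

Section Perturbation.
Context {R : realType}.
Implicit Types H K L : hilbertType R.

Lemma quadratic_ivt (a b c : R) : a * (a + b + c) <= 0 ->
  exists2 u, 0 <= u <= 1 & a + b * u + c * u ^+ 2 = 0.
Proof.
move=> abc; wlog a0 : a b c abc / a <= 0.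
  move=> hw; have [|a0] := leP a 0; first exact: hw.
  have [||u u01 uE] := hw (- a) (- b) (- c); first by lra.
    by rewrite oppr_le0 ltW.
  by exists u => //; lra.
pose p := a%:P + b *: 'X + c *: 'X^2.
have pE u : p.[u] = a + b * u + c * u ^+ 2.
  by rewrite !hornerE.
have [a00|an0] := eqVneq a 0.
  by exists 0; rewrite ?lexx ?ler01// a00; ring.
have [] := @poly_ivt R p 0 1 ler01.
  rewrite !pE expr1n !mulr1 mulr0 expr0n /= mulr0 !addr0 a0 /=.
  by rewrite -(nmulr_rle0 _ (_ : a < 0))// lt_neqAle an0.
by move=> u u01 /rootP; rewrite pE; exists u.
Qed.

Lemma rational_between (k x y : R) : x < y ->
  exists2 r, x < r < y & rational (r - k).
Proof.
move=> xy; have xy' : x - k < y - k by lra.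
have [q] := rat_in_itvoo xy'; rewrite in_itv /= => /andP[xq qy].
by exists (ratr q + k); [lra|exists q => //; rewrite addrK].
Qed.

(** Such an [r] is found as a rational number plus [pi + k], and [pi] is irrational. *)
Lemma irrational_between (k x y : R) : x < y ->
  exists2 r, x < r < y & ~ rational (r - k).
Proof.
move=> xy; have xy' : x - k - pi < y - k - pi by lra.
have [q] := rat_in_itvoo xy'; rewrite in_itv /= => /andP[xq qy].
exists (ratr q + pi + k); first by lra.
rewrite addrK => -[q' _ q'E]; apply: (@pi_irrationnal R).
by exists (q' - q) => //; rewrite rmorphB /= q'E addrAC subrr add0r.
Qed.

(** The real part of the Rayleigh quotient of [a] is constant on [W], phrased without division. *)
Definition flat_on H (W : set H) (a : H -> H) :=
  exists k : R, forall w, W w ->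
    complex.Re (dotp (a w) w) = k * complex.Re (dotp w w).

(* The Rayleigh quotient of a is not locally constant on W, hence by the
   intermediate value theorem it takes values in D arbitrarily close to any
   vector. *)
Lemma rayleigh_pos H (a c : H -> H) (W : set H) (D : set R) :
  bop a -> bop c -> subspace W -> ~ flat_on W a ->
  (forall x y : R, x < y -> exists2 r, x < r < y & D r) ->
  (forall v, W v -> dotp v v = 1 -> D (complex.Re (dotp (a v) v)) ->
     0 <= dotp (c v) v) ->
  forall v, W v -> 0 <= dotp (c v) v.
Proof.
move=> ba bc Ws nflat Dd cD v Wv.
pose N (x : H) : R := complex.Re (dotp x x).
pose Q (x : H) : R := complex.Re (dotp (a x) x).
have NE x : (N x)%:C = dotp x x by apply: RRe_real; exact/ger0_real/dotp_ge0.
have N0 x : x != 0 -> 0 < N x.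
  move=> x0; rewrite -ltcR NE lt_def dotp_ge0 andbT.
  by apply: contra_neq x0 => /dotp_eq0.
have ReM (k : R) (z : R[i]) : complex.Re (k%:C * z) = k * complex.Re z.
  by case: z => z1 z2 /=; rewrite mul0r subr0.
have ReD (y z : R[i]) : complex.Re (y + z) = complex.Re y + complex.Re z.
  by case: y z => ? ? [].
have opE (d : H -> H) (t : R) x w : bop d ->
    dotp (d (x + t%:C *: w)) (x + t%:C *: w) = dotp (d x) x +
      t%:C * (dotp (d x) w + dotp (d w) x) + (t ^+ 2)%:C * dotp (d w) w.
  move=> bd; rewrite bopD// bopZ// !dotpDl !dotpDr !dotpZl !dotpZr !conjCR.
  by rewrite rmorphXn /=; ring.
have opZ (d : H -> H) (t : R) x : bop d ->
    dotp (d (t%:C *: x)) (t%:C *: x) = (t ^+ 2)%:C * dotp (d x) x.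
  by move=> bd; rewrite bopZ// dotpZl dotpZr conjCR rmorphXn /=; ring.
have hom x : W x -> x != 0 -> D (Q x / N x) -> 0 <= dotp (c x) x.
  move=> Wx x0 Dx; have Nx := N0 _ x0.
  pose k := (Num.sqrt (N x))^-1; have k0 : 0 < k by rewrite invr_gt0 sqrtr_gt0.
  have k2 : k ^+ 2 = (N x)^-1 by rewrite exprVn sqr_sqrtr// ltW.
  have k20 : 0 < (k ^+ 2)%:C by rewrite ltcR exprn_gt0.
  rewrite -(pmulr_rge0 _ k20) -opZ//; apply: cD.
  - exact: subspaceZ.
  - rewrite -[dotp _ _]/(dotp (idfun (k%:C *: x)) _) opZ; last exact: bop_id.
    by rewrite /= -NE k2 -rmorphM /= mulVf// gt_eqF.
  - by rewrite opZ// ReM k2 mulrC.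
have [->|v0] := eqVneq v 0; first by rewrite bop0// dotp0l.
have Nv := N0 _ v0; pose q := Q v / N v.
(* [a] is not flat with the constant [q], so some [w] has a quotient different from that of [v]. *)
have [w Ww hw] : exists2 w, W w & Q w - q * N w != 0.
  apply/not_exists2P => flat; apply: nflat; exists q => w Ww.
  by have [//|/negP] := flat w; rewrite negbK subr_eq0 => /eqP.
have Nex t : N (v + t%:C *: w) =
    N v + t * complex.Re (dotp v w + dotp w v) + t ^+ 2 * N w.
  by rewrite /N (opE idfun t v w (@bop_id R H)) !ReD !ReM ReD.
have Qex t : Q (v + t%:C *: w) =
    Q v + t * complex.Re (dotp (a v) w + dotp (a w) v) + t ^+ 2 * Q w.
  by rewrite /Q opE// !ReD !ReM ReD.
set C := complex.Re _ in Nex; set B := complex.Re _ in Qex.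
have qN : Q v = q * N v by rewrite /q divfK// gt_eqF.
(* Otherwise [v] would be a nonzero multiple of [w] and the two quotients would agree. *)
have vw0 t : v + t%:C *: w != 0.
  apply/eqP => vw; have vE : v = (- t)%:C *: w.
    by apply/eqP; rewrite rmorphN scaleNr -addr_eq0 vw.
  move: qN; rewrite /Q /N [X in dotp (a X) X]vE [X in dotp X X]vE opZ//.
  rewrite (opZ idfun _ _ (@bop_id R H)) !ReM sqrrN mulrCA => /eqP.
  rewrite -subr_eq0 -mulrBr mulf_eq0 (negbTE hw) orbF sqrf_eq0 => /eqP t0.
  by move: v0; rewrite vE t0 oppr0 scale0r eqxx.
apply: ge0_approx => _ /gt0_complexP[e e0 ->].
pose s := `|dotp (c v) w + dotp (c w) v| + `|dotp (c w) w|.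
have [s' s'0 sE] : exists2 s' : R, 0 <= s' & s = s'%:C.
  have s0 : 0 <= s by rewrite addr_ge0.
  by exists (complex.Re s); rewrite -?ler0c (RRe_real (ger0_real s0)).
(* Small enough for a perturbation of size at most [t1] to move the form of [c] by at most [e]. *)
pose t1 := e / (s' + 1 + e).
have D0 : 0 < s' + 1 + e by lra.
have t10 : 0 < t1 by rewrite divr_gt0.
have t11 : t1 <= 1 by rewrite /t1 ler_pdivrMr//; lra.
have t1s : t1 * s' <= e by rewrite /t1 mulrAC ler_pdivrMr//; nra.
suff [t tt1 Dt] : exists2 t, `|t| <= t1 &
    D (Q (v + t%:C *: w) / N (v + t%:C *: w)).
  exists (dotp (c (v + t%:C *: w)) (v + t%:C *: w)).
    by apply: hom => //; apply: subspaceD => //; exact: subspaceZ.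
  have nR (z : R) : `|z%:C| = `|z|%:C.
    by rewrite normc_def /= expr0n addr0 sqrtr_sqr.
  rewrite opE// -!addrA opprD addrA subrr add0r normrN.
  rewrite (le_trans (ler_normD _ _))// !normrM !nR.
  have : (t1 * s')%:C <= e%:C by rewrite lecR.
  apply: le_trans; rewrite rmorphM /= -sE /s mulrDr lerD// ler_wpM2r// lecR//.
  by rewrite normrX (le_trans _ tt1)// expr2 ler_piMl// (le_trans tt1).
(* As a function of [t], [Q - q * N] at [v + t%:C *: w] vanishes at 0 and has a nonzero quadratic
   coefficient, so it cannot vanish at both [t1] and [- t1]. *)
have [t2 t2E ht2] : exists2 t2, `|t2| = t1 &
    Q (v + t2%:C *: w) - q * N (v + t2%:C *: w) != 0.
  have [h1|h1] := eqVneq (Q (v + t1%:C *: w) - q * N (v + t1%:C *: w)) 0;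
    last by exists t1 => //; rewrite gtr0_norm.
  exists (- t1); first by rewrite normrN gtr0_norm.
  have t12 : t1 ^+ 2 != 0 by rewrite sqrf_eq0 gt_eqF.
  apply: contra_neq hw => h2; apply: (mulfI t12); move: h1 h2.
  by rewrite !Nex !Qex qN; nra.
pose n2 := N (v + t2%:C *: w); have n20 : 0 < n2 by exact: N0.
pose q2 := Q (v + t2%:C *: w) / n2.
have q2N : Q (v + t2%:C *: w) = q2 * n2 by rewrite /q2 divfK// gt_eqF.
have qq2 : q != q2.
  by apply: contra_neq ht2 => qE; rewrite q2N -/n2 -qE subrr.
(* [r] lies strictly between the quotients at [v] and at [v + t2%:C *: w]. *)
have [r Dr rq] : exists2 r, D r & (q - r) * (q2 - r) < 0.
  move: qq2; rewrite neq_lt => /orP[] /Dd[r /andP[r1 r2] Dr]; exists r => //; nra.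
(* [Q - r * N] changes sign on the segment from [v] to that point; [u] is the position of a zero. *)
have [|u /andP[u0 u1] uE] := @quadratic_ivt (Q v - r * N v)
    (t2 * (B - r * C)) (t2 ^+ 2 * (Q w - r * N w)).
  have -> : Q v - r * N v + t2 * (B - r * C) + t2 ^+ 2 * (Q w - r * N w)
      = Q (v + t2%:C *: w) - r * n2 by rewrite /n2 Nex Qex; ring.
  rewrite q2N qN -!mulrBl mulrACA; apply: ltW; rewrite nmulr_rlt0//.
  exact: mulr_gt0.
exists (u * t2).
  by rewrite normrM t2E ger0_norm// ler_piMl// ltW.
suff -> : Q (v + (u * t2)%:C *: w) / N (v + (u * t2)%:C *: w) = r by [].
apply/eqP; rewrite eq_sym -(inj_eq (mulIf (lt0r_neq0 (N0 _ (vw0 (u * t2)))))).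
rewrite divfK ?(lt0r_neq0 (N0 _ (vw0 (u * t2))))//.
by rewrite Nex Qex; apply/eqP; nra.
Qed.

End Perturbation.

(** * Splitting the universal space according to rationality of state values *)

Section Hotel.
Context {R : realType}.
Implicit Types H K L : hilbertType R.

(** The form at a sum of two vectors shows that the symmetrised cross term vanishes; replacing [y]
    by ['i%R *: y] turns this sum of two terms into their difference. *)
Lemma polarization H (d : H -> H) : bop d -> (forall x, dotp (d x) x = 0) ->
  forall x, d x = 0.
Proof.
move=> bd d0 x; apply: dotp_eq0; suff dxy y : dotp (d x) y = 0 by exact: dxy.
have d1 u v : dotp (d u) v + dotp (d v) u = 0.
  have := d0 (u + v); rewrite bopD// !dotpDl !dotpDr !d0 add0r addr0.
  by rewrite addrC.
have e1 := d1 x y; have := d1 x ('i%R *: y).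
rewrite bopZ// dotpZl dotpZr conjCi mulNr addrC -mulrBr => /eqP.
rewrite mulf_eq0 (negbTE (neq0Ci _)) /= subr_eq0 => /eqP e2; move: e1; rewrite e2.
by rewrite -mulr2n => /eqP; rewrite mulrn_eq0 /= => /eqP.
Qed.

(** Flatness of [a] determines the real part of the quadratic form and flatness of ['i%C *: a] the
    imaginary part; [polarization] then determines the operator. *)
Lemma scalar_of_flat K (U : hilbertType R) (A : set (K -> K))
    (rho : (K -> K) -> (U -> U)) a :
  unital_rep A rho -> (forall a, A a -> flat_on setT (rho a)) -> A a ->
  exists z : R[i], forall x, rho a x = z *: x.
Proof.
move=> rU flat Aa; have [k kE] := flat _ Aa; have As := alg_subspace rU.
have Aia : A ('i%C *: a) by exact: subspaceZ.
have iaE x : rho ('i%C *: a) x = 'i%C *: rho a x.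
  have := rep_lin rU 'i%C x Aa (proj1 As).
  by rewrite (rep0 rU) !addr0.
have [l lE] := flat _ Aia.
have ba := rep_bop rU Aa.
exists (k -i* l) => x; apply/subr0_eq; move: x.
pose d y := rho a y - (k -i* l) *: y.
have bd : bop d.
  have -> : d = - (k -i* l) *: idfun + rho a.
    by apply/funext => y; rewrite /d addrC -scaleNr.
  by case: (bop_subspace U U) => _; apply; [exact: bop_id|].
apply: (polarization bd) => x; rewrite /d dotpBl dotpZl.
have NE : dotp x x = (complex.Re (dotp x x))%:C.
  by rewrite RRe_real//; exact/ger0_real/dotp_ge0.
have := lE x I; have := kE x I; rewrite iaE dotpZl [_ * dotp _ x]mulrC ReiNIm.
rewrite [in (_ -i* _) * _]NE; set n := complex.Re (dotp x x).
case: (dotp (rho a x) x) => u v /= -> /(canRL opprK) ->.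
by apply/eqP; rewrite eq_complex /=; apply/andP; split; apply/eqP; ring.
Qed.

Section Universal.
Context K (U : hilbertType R) (A : set (K -> K)) (rho : (K -> K) -> (U -> U))
  (xi : ((K -> K) -> R[i]) -> U).
Hypotheses (cA : cstar_subalgebra A) (A1 : A idfun).
Hypothesis rhoA : star_morphism A rho.
Hypothesis xi_state : forall f, is_state A f ->
  forall a, A a -> dotp (rho a (xi f)) (xi f) = f a.
Hypothesis xi_eq : forall f g, is_state A f -> is_state A g ->
  {in A, f =1 g} -> xi f = xi g.
Hypothesis xi_orth : forall f g, is_state A f -> is_state A g ->
  ~ {in A, f =1 g} ->
  forall a b, A a -> A b -> dotp (rho a (xi f)) (rho b (xi g)) = 0.
Hypothesis xi_dense : dense (lspan [set v | exists f a,
  [/\ is_state A f, A a & v = rho a (xi f)]]).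

Let rU : unital_rep A rho.
Proof. exact: universal_unital xi_dense. Qed.

Let span_all x : state_span A rho xi setT x.
Proof. exact: state_span_setT. Qed.

Lemma states_separate c : A c -> (forall f, is_state A f -> 0 <= f c) ->
  forall x, 0 <= dotp (c x) x.
Proof.
move=> Ac fc x; have [->|x0] := eqVneq x 0; first by rewrite dotp0r.
have bc : bop c by case: cA => + _ _ _ _; exact.
have := fc _ (vector_state_id A (dotp_normalize x0)).
by rewrite quad_normalize_ge0.
Qed.

Lemma state_span_rep F a x : A a ->
  state_span A rho xi F x -> state_span A rho xi F (rho a x).
Proof.
move=> Aa; apply: hclosure_invariant; first exact: (rep_bop rU Aa).
have [span0 spanP] := lspan_subspace [set v | exists f b,
    [/\ is_state A f /\ F f, A b & v = rho b (xi f)]].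
apply: smallest_sub => /=.
  have ba := rep_bop rU Aa; split; first by rewrite /= bop0.
  by move=> k y z /= ly lz; rewrite bopD// bopZ//; exact: spanP.
move=> _ [f [b [fF Ab ->]]]; apply: sub_lspan => /=.
exists f, (a \o b); split=> //; first exact: (alg_comp rU).
by rewrite (rep_comp rU).
Qed.

Lemma rep_conj c a a' v : A c -> A a -> A a' -> adjoint a a' ->
  dotp (rho (a' \o (c \o a)) v) v = dotp (rho c (rho a v)) (rho a v).
Proof.
move=> Ac Aa Aa' aa'; have Aca := alg_comp rU Ac Aa.
by rewrite (rep_comp rU)// (rep_comp rU)// -(rep_adjoint rU Aa' (adjointC aa')).
Qed.

(** The last hypothesis says that positivity on the range of [p0] can be tested on unit vectors
    whose value at [a0] has real part [k] plus a rational; it keeps [p1] from losing information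
    about [p0]. *)
Lemma hotel_step (p0 : projector U) (a0 : K -> K) (k : R) :
  commutes_with A rho p0 -> A a0 -> ~ flat_on setT (rho a0) ->
  (forall c, A c -> (forall v, p0 v = v -> dotp v v = 1 ->
     rational (complex.Re (dotp (rho a0 v) v) - k) -> 0 <= dotp (rho c v) v) ->
     pos_on rho p0 c) ->
  exists p1 : projector U, [/\ commutes_with A rho p1,
    forall c, A c -> pos_on rho p0 c <-> pos_on rho p1 c
  & forall c, A c -> pos_on rho (projC p1) c -> forall x, 0 <= dotp (c x) x].
Proof.
move=> p0c Aa0 nflat dens0.
(* Both F and its complement are met by the vector states of a dense set of
   vectors: those of range p0, respectively of the whole space. *)
pose F (f : (K -> K) -> R[i]) := rational (complex.Re (f a0) - k) /\
  forall c, A c -> pos_on rho p0 c -> 0 <= f c.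
pose W := state_span A rho xi F.
have Ws : subspace W by apply: hclosure_subspace; exact: lspan_subspace.
have [p1 [p1W p1fix]] := projector_onto Ws (@hclosure_closed _ _ _).
have p1c : commutes_with A rho p1.
  by apply: (invariant_commutes rU p1W p1fix) => a Aa x; exact: state_span_rep.
exists p1; split=> // c Ac.
- split=> [cpos x p1x|cpos].
    (* States in [F] are nonnegative on whatever is positive on the range of [p0], in particular on
       the conjugates of [c]. *)
    apply: (state_span_pos cA A1 rhoA xi_eq xi_orth xi_dense (F := F)) => //;
      last by rewrite -p1x; exact: p1W.
    move=> f a fs [_ Ff] Aa; have [a' Aa' aa'] := alg_adjoint rU Aa.
    have Ad : A (a' \o (c \o a)).
      by apply: (alg_comp rU) => //; exact: (alg_comp rU).
    rewrite -(rep_conj _ Ac Aa Aa' aa') xi_state//; apply: Ff => // v p0v.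
    rewrite (rep_conj _ Ac Aa Aa' aa'); apply: cpos.
    by rewrite -(commutes_withE _ p0c Aa) p0v.
  (* The vector state of [v] belongs to [F], so its GNS vector lies in the range of [p1]. *)
  apply: dens0 => // v p0v v1 qv.
  have vs := vector_state cA A1 rhoA xi_state xi_eq xi_orth xi_dense v1.
  rewrite -[dotp _ _]/((fun a => dotp (rho a v) v) c) -xi_state//; apply: cpos.
  apply: p1fix; apply: hclosure_sub; apply: sub_lspan.
  exists (fun a => dotp (rho a v) v), idfun; split=> //; last by rewrite (rep_id rU).
  by split=> //; split=> // d Ad dpos; exact: dpos.
- move=> cpos; apply: states_separate => // f fs; rewrite -xi_state//.
  (* By density of the reals outside [k] plus the rationals, only unit vectors with such a value at
     [a0] have to be tested. *)
  suff : forall v, setT v -> 0 <= dotp (rho c v) v by apply.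
  apply: (rayleigh_pos (rep_bop rU Aa0) (rep_bop rU Ac) _ nflat
    (irrational_between k)).
    by split.
  move=> v _ v1 qv {f fs}.
  pose f := fun a => dotp (rho a v) v.
  have fs : is_state A f.
    exact: (vector_state cA A1 rhoA xi_state xi_eq xi_orth xi_dense v1).
  rewrite -[dotp _ _]/(f c) -xi_state//; apply: cpos.
  (* A state in [F] has another value at [a0] than the vector state of [v], so [xi f] is orthogonal
     to all of [W]. *)
  suff p1f : p1 (xi f) = 0 by rewrite /= p1f subr0.
  have orth : W `<=` [set x | forall y, [set xi f] y -> dotp x y = 0].
    apply: hclosure_min; last exact: hclosed_orth.
    apply: smallest_sub.
      split; first by move=> y _; rewrite dotp0l.
      move=> l x y Wx Wy z fz.
      by rewrite dotpDl dotpZl Wx// Wy// mulr0 addr0.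
    move=> _ [g [a [[gs [Fg _]] Aa ->]]] _ ->.
    rewrite -[xi f](rep_id rU); apply: xi_orth => // gf.
    by apply: qv; rewrite -[dotp _ _]/(f a0) -gf// inE.
  apply: dotp_eq0; rewrite -(proj_sadj p1).
  by have /(congr1 (fun g => g (xi f))) /= -> := proj_idem p1; exact: orth.
Qed.

(** Here [rho] takes scalar values, so all states agree on [A] and share one cyclic vector [u]; the
    space is zero or the line through [u]. *)
Lemma flat_dichotomy (p : projector U) : commutes_with A rho p ->
  (forall a, A a -> flat_on setT (rho a)) ->
  (forall x, p x = x) \/ (forall x, p x = 0).
Proof.
move=> pc flat.
have scal a : A a -> exists z : R[i], forall x, rho a x = z *: x.
  exact: scalar_of_flat.
have bp := proj_bop p.
have [[f fs]|nos] := pselect (exists f, is_state A f); last first.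
  left=> x; suff -> : x = 0 by rewrite bop0.
  suff : state_span A rho xi setT `<=` [set 0] by apply.
  apply: hclosure_min.
    apply: smallest_sub.
      by split=> // k y z -> ->; rewrite scaler0 addr0.
    by move=> v [g [a [[gs _] _ _]]]; case: nos; exists g.
  move=> y y0; apply/eqP; rewrite -normr_le0; apply/ler_addgt0Pl => e e0.
  by have [_ -> ] := y0 e e0; rewrite subr0 addr0.
have xi1 g : is_state A g -> dotp (xi g) (xi g) = 1.
  move=> gs; have [_ _ <-] := gs.
  by rewrite -(xi_state gs A1) (rep_id rU).
pose u := xi f.
have xiE g : is_state A g -> xi g = u.
  move=> gs; apply: xi_eq => // a; rewrite inE => Aa.
  rewrite -!xi_state//; have [z zE] := scal _ Aa.
  by rewrite !zE !dotpZl !xi1.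
have line x : x = dotp x u *: u.
  apply/eqP; rewrite -subr_eq0; apply/eqP; set y := _ - _.
  have yu : dotp y u = 0 by rewrite dotpBl dotpZl xi1// mulr1 subrr.
  apply: dotp_eq0.
  suff : state_span A rho xi setT `<=`
      [set w | forall y', [set y] y' -> dotp w y' = 0].
    by apply.
  apply: hclosure_min; last exact: hclosed_orth.
  apply: smallest_sub.
    split; first by move=> ? _; rewrite dotp0l.
    by move=> k a b Wa Wb c cy; rewrite dotpDl dotpZl Wa// Wb// mulr0 addr0.
  move=> _ [g [a [[gs _] Aa ->]]] _ ->; have [z ->] := scal _ Aa.
  by rewrite xiE// dotpZl dotpC yu conjC0 mulr0.
have puE := line (p u); set c := dotp (p u) u in puE.
(* [c] is the scalar by which [p] acts on the line, so idempotency leaves only 0 and 1. *)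
have : c * c = c.
  rewrite {3}/c -[p u](congr1 (fun g => g u) (proj_idem p)) /= puE bopZ// puE.
  by rewrite !dotpZl xi1// mulr1.
move/eqP; rewrite -subr_eq0 -[X in _ - X]mulr1 -mulrBr mulf_eq0.
case/orP => [/eqP c0|].
  by right=> x; rewrite [x]line bopZ// puE c0 scale0r scaler0.
rewrite subr_eq0 => /eqP c1.
by left=> x; rewrite {1}[x]line bopZ// puE c1 scale1r -line.
Qed.

Lemma hilbert_hotel_aux (p0 : projector U) : commutes_with A rho p0 ->
  (forall x, p0 x = x) \/
  exists p1 : projector U, [/\ commutes_with A rho p1,
    forall c, A c -> pos_on rho p0 c <-> pos_on rho p1 c
  & forall c, A c -> pos_on rho (projC p1) c -> forall x, 0 <= dotp (c x) x].
Proof.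
move=> p0c; have bp0 := proj_bop p0.
have p0s : subspace [set x | p0 x = x].
  split; first by rewrite /= bop0.
  by move=> k x y /= px py; rewrite bopD// bopZ// px py.
have [flat|] := pselect (forall a, A a -> flat_on setT (rho a)).
  (* All operators are scalars: [p0] is the identity or zero, and in the latter case [p1 = p0] works
     since its complement acts as the identity. *)
  have [p01|p00] := flat_dichotomy p0c flat; first by left.
  right; exists p0; split=> // c Ac cpos; apply: states_separate => // f fs.
  by rewrite -xi_state//; apply: cpos; rewrite /= p00 subr0.
move=> /existsNP[a1 /not_implyP[Aa1 nflat1]]; right.
(* If some [a] is not flat on the range of [p0], vectors with rational values are dense enough
   there, and [k = 0] will do. *)
have [[a [Aa nflat]]|flat] :=
    pselect (exists a, A a /\ ~ flat_on [set x | p0 x = x] (rho a)).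
  apply: (@hotel_step p0 a 0) => //.
    by move=> [k kE]; apply: nflat; exists k => w _; exact: kE.
  move=> c Ac cpos v p0v.
  apply: (rayleigh_pos (rep_bop rU Aa) (rep_bop rU Ac) p0s nflat
    (rational_between 0)) => //.
(* Otherwise the value of [a1] at unit vectors of that range has constant real part [k], and
   subtracting [k] leaves the rational number 0. *)
have [k kE] : flat_on [set x | p0 x = x] (rho a1).
  by apply: contrapT => nf; apply: flat; exists a1.
apply: (@hotel_step p0 a1 k) => // c Ac cpos v p0v.
have [->|v0] := eqVneq v 0; first by rewrite dotp0r.
have v1 := dotp_normalize v0.
have pv : p0 (`|v|^-1 *: v) = `|v|^-1 *: v by rewrite bopZ// p0v.
have bc := rep_bop rU Ac.
have := cpos _ pv v1; rewrite kE// v1 /= mulr1 subrr.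
have r0 : rational (0 : R) by exists 0; rewrite ?rmorph0.
by move=> /(_ r0); rewrite quad_normalize_ge0.
Qed.

End Universal.

Lemma hilbert_hotel K (U : hilbertType R) (A : set (K -> K))
    (rho : (K -> K) -> (U -> U)) (p0 : projector U) :
  cstar_subalgebra A -> A idfun -> is_universal_rep A rho ->
  commutes_with A rho p0 ->
  (forall x, p0 x = x) \/
  exists p1 : projector U, [/\ commutes_with A rho p1,
    forall c, A c -> pos_on rho p0 c <-> pos_on rho p1 c
  & forall c, A c -> pos_on rho (projC p1) c -> forall x, 0 <= dotp (c x) x].
Proof.
move=> cA A1 [rhoA [xi [xi_state xi_eq xi_orth xi_dense]]].
exact: (hilbert_hotel_aux cA A1 rhoA xi_state xi_eq xi_orth xi_dense).
Qed.

End Hotel.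

(** * Order, norm and commutation in the universal representation *)

Section Commutation.
Context {R : realType} {K U : hilbertType R}.
Variables (A : set (K -> K)) (rho : (K -> K) -> (U -> U)).
Hypotheses (cA : cstar_subalgebra A) (A1 : A idfun).
Hypothesis uA : is_universal_rep A rho.

Lemma universal_rep_unital : unital_rep A rho.
Proof.
by have [rhoA [xi [_ _ _ xi_dense]]] := uA; exact: universal_unital xi_dense.
Qed.
Let rU := universal_rep_unital.

Lemma universal_rep_pos c : A c -> (forall x, 0 <= dotp (c x) x) ->
  forall x, 0 <= dotp (rho c x) x.
Proof.
have [rhoA [xi [h1 h2 h3 h4]]] := uA; move=> Ac cpos.
exact: (universal_pos cA A1 rhoA h1 h2 h3 h4).
Qed.

Lemma universal_rep_reflects_pos c : A c -> (forall x, 0 <= dotp (rho c x) x) ->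
  forall x, 0 <= dotp (c x) x.
Proof.
have [rhoA [xi [h1 h2 h3 h4]]] := uA; move=> Ac cpos.
by apply: (states_separate cA) => // f fs; rewrite -h1.
Qed.

(** The bound says that [e ^+ 2] minus [d' \o d] is positive, and [rho] preserves positivity. *)
Lemma universal_rep_norm d (e : R[i]) : A d -> 0 <= e ->
  (forall x, `|d x| <= e * `|x|) -> forall x, `|rho d x| <= e * `|x|.
Proof.
move=> Ad e0 de x; have [d' Ad' dd'] := alg_adjoint rU Ad.
have As := alg_subspace rU; have Add := alg_comp rU Ad' Ad.
pose c := (-1) *: (d' \o d) + (e ^+ 2 *: idfun + 0).
have A1e : A (e ^+ 2 *: idfun + 0) by case: As => A0; apply.
have Ac : A c by case: As => _; apply.
have quadE (L : hilbertType R) (pi : (K -> K) -> (L -> L)) y :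
    unital_rep A pi -> dotp (pi c y) y = (e * `|y|) ^+ 2 - `|pi d y| ^+ 2.
  move=> piA; rewrite (rep_lin piA)// (rep_lin piA)//; last by case: As.
  rewrite (rep_id piA) (rep0 piA) addr0 (rep_comp piA)// dotpDl !dotpZl mulN1r.
  by rewrite (adjointC (rep_adjoint piA Ad dd')) !dotpp_norm exprMn addrC.
have := universal_rep_pos Ac _ x.
rewrite quadE// subr_ge0 ler_pXn2r ?nnegrE ?mulr_ge0//; apply=> y.
by rewrite (quadE _ id)// ?subr_ge0 ?ler_pXn2r ?nnegrE ?mulr_ge0//; exact: id_rep.
Qed.

End Commutation.

Section Generators.
Context {R : realType} {K U : hilbertType R}.
Variables (X : set (K -> K)) (rho : (K -> K) -> (U -> U)) (p : projector U).
Hypotheses (Xb : X `<=` bop) (X1 : X idfun).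
Hypothesis uX : is_universal_rep (cstar_gen X) rho.

(** The elements whose image commutes with [p] form a C*-algebra; that they are closed in norm rests
    on [universal_rep_norm]. *)
Lemma commutes_generators :
  (forall a, X a -> rho a \o p = p \o rho a) -> commutes_with (cstar_gen X) rho p.
Proof.
move=> Xp; have cA := cstar_gen_cstar Xb.
have A1 : cstar_gen X idfun by apply: sub_gen_smallest.
have rU := universal_rep_unital cA A1 uX; have bp := proj_bop p.
pose B := [set a | cstar_gen X a /\ rho a \o p = p \o rho a].
suff AB : cstar_gen X `<=` B by move=> a /AB[].
have [Ab As AM Aad Ac] := cA.
have BE a x : B a -> rho a (p x) = p (rho a x).
  by move=> [_ /(congr1 (fun f => f x))].
apply: smallest_sub; last first.
  by move=> a Xa; split; [exact: sub_gen_smallest|exact: Xp].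
split.
- by move=> a [/Ab].
- split.
    split; first by case: As.
    by apply/funext => x /=; rewrite !(rep0 rU) bop0.
  move=> k a b aB bB; have [Aa _] := aB; have [Ab' _] := bB.
  split; first by case: As => _; exact.
  apply/funext => x /=; rewrite !(rep_lin rU)// bopD// bopZ//.
  by rewrite (BE a)// (BE b).
- move=> a b aB bB; have [Aa _] := aB; have [Ab' _] := bB.
  split; first exact: AM.
  apply/funext => x /=; rewrite (rep_comp rU (p x) Aa Ab').
  by rewrite (rep_comp rU x Aa Ab') (BE b _ bB) (BE a _ aB).
- move=> a a' aB aa'; have [Aa _] := aB; have Aa' := Aad _ _ Aa aa'.
  split=> //; apply/funext => x /=; apply: dotp_extl => y.
  have raa' := rep_adjoint rU Aa' (adjointC aa').
  by rewrite raa' !(proj_sadj p) raa' (BE a).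
- move=> g [bg gB]; have Ag : cstar_gen X g.
    by apply: Ac; split=> // e /gB[b [Ab' _] gb]; exists b.
  split=> //; apply/funext => x /=; apply/eqP; rewrite -subr_eq0 -normr_le0.
  have [M M0 pM] := bop_bound bp.
  apply/ler_addgt0Pl => e e0; rewrite addr0.
  pose C := `|p x| + M%:C * `|x| + 1.
  have C0 : 0 < C by rewrite ltr_wpDl// addr_ge0// mulr_ge0// ler0c ltW.
  have d0 : 0 < e / C by rewrite divr_gt0.
  have [b bB gb] := gB _ d0; have [Ab' _] := bB.
  have Agb : cstar_gen X (g - b) by exact: (subspaceB As Ag Ab').
  have rgb y : rho g y - rho b y = rho (g - b) y.
    have -> : g - b = (-1) *: b + g by rewrite scaleN1r addrC.
    by rewrite (rep_lin rU)// scaleN1r addrC.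
  have nrm := universal_rep_norm cA A1 uX Agb (ltW d0) gb.
  (* The image of [b] commutes with [p], so the commutator for [g] equals the one for [g - b], and
     [rho (g - b)] is bounded by [e / C]. *)
  have -> : rho g (p x) - p (rho g x) = rho (g - b) (p x) - p (rho (g - b) x).
    by rewrite -!rgb bopB// (BE b)// opprB addrA subrK.
  rewrite (le_trans (ler_normB _ _))// (le_trans (lerD (nrm _) (pM _)))//.
  have M0' : 0 <= M%:C by rewrite ler0c ltW.
  rewrite (le_trans (lerD (lexx _) (ler_wpM2l M0' (nrm _))))//.
  rewrite mulrCA -mulrDr mulrAC ler_pdivrMr// ler_wpM2l ?(ltW e0)//.
  by rewrite lerDl.
Qed.

End Generators.

(** * Delta-equivalence *)

Section DeltaEquivalence.
Context {R : realType}.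
Implicit Types H K L : hilbertType R.

(** The witnessing TRO is replaced by the set [N] of its adjoints, which exchanges the two
    non-degeneracy conditions and the two inclusions. *)
Lemma Delta_equivalent_sym H K (S : set (H -> H)) (T : set (K -> K)) :
  Delta_equivalent S T -> Delta_equivalent T S.
Proof.
move=> [H' [K' [phi [psi [uS uT [M [[Mb Ms MT] [nd1 nd2] M1 M2]]]]]]].
exists K', H', psi, phi; split=> //.
pose N := [set a' : K' -> H' | exists2 a, M a & adjoint a a'].
have NM a a' : N a -> adjoint a a' -> M a'.
  move=> [b Mb' ba] aa'; suff -> : a' = b by [].
  exact: adjoint_uniq aa' (adjointC ba).
have Nbop a : N a -> bop a.
  by move=> [b Mb' ba]; apply: adjoint_bop ba; exact: Mb.
have MN a : M a -> exists2 a', N a' & adjoint a a'.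
  move=> Ma; have [a' _ aa'] := ex_adjoint (Mb _ Ma).
  by exists a' => //; exists a.
exists N; split.
- split.
  exact: Nbop.
  split; first by exists 0; [case: Ms|move=> x y; rewrite dotp0l dotp0r].
    move=> k x y [a Ma aa'] [b Mb' bb']; exists (Num.conj k *: a + b).
      by case: Ms => _; apply.
    by have := adjoint_lin (Num.conj k) aa' bb'; rewrite conjCK.
  move=> a' b' b2 c' Na Nb Nc bb2.
    have [a Ma aa'] := Na; have [c Mc cc'] := Nc; have Mb2 := NM _ _ Nb bb2.
    exists ((c \o b') \o a); first exact: MT Mc Mb2 Ma (adjointC bb2).
    exact: (adjoint_comp aa' (adjoint_comp bb2 cc')).
- split.
    suff <- : [set f | exists a b b', [/\ M a, M b, adjoint b b' & f = a \o b']] =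
      [set f | exists a a' b, [/\ N a, N b, adjoint a a' & f = a' \o b]] by [].
    apply/seteqP; split=> f [a [b [c [h1 h2 h3 ->]]]].
      have [a' Na aa'] := MN _ h1; exists a', a, c; split=> //; last exact: adjointC.
      by exists b.
    by have [d Md dc] := h2; exists b, d, c; split=> //; exact: NM h3.
  suff <- : [set f | exists a a' b, [/\ M a, M b, adjoint a a' & f = a' \o b]] =
    [set f | exists a b b', [/\ N a, N b, adjoint b b' & f = a \o b']] by [].
  apply/seteqP; split=> f [a [b [c [h1 h2 h3 ->]]]].
    have [c' Nc cc'] := MN _ h2; exists b, c', c; split=> //; last exact: adjointC.
    by exists a.
  by have [d Md da] := h1; exists d, a, c; split=> //; exact: NM h3.
- move=> a' a b' t Na Nb aa' [s Ss <-].
  have Ma := NM _ _ Na aa'; have [b Mb' bb'] := Nb.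
  by apply: (M2 _ _ _ _ Ma Mb' bb'); exists s.
- move=> a' b' b s Na Nb bb' [t Tt <-].
  have Mb' := NM _ _ Nb bb'; have [a Ma aa'] := Na.
  by apply: (M1 _ _ _ _ Ma Mb' aa'); exists t.
Qed.

Lemma mxpos1 H (d : H -> H) :
  mxpos (const_mx d : 'M[H -> H]_1) <-> forall x, 0 <= dotp (d x) x.
Proof.
split=> [dpos x|dpos x].
  by have := dpos (fun=> x); rewrite !big_ord1 mxE.
by rewrite !big_ord1 mxE.
Qed.

(** * Transport of Delta-equivalence along complete order isomorphisms *)

Section Transfer.
Context {H0 H1 H2 : hilbertType R}.
Variables (X : set (H0 -> H0)) (alpha : (H0 -> H0) -> (H1 -> H1))
  (beta : (H0 -> H0) -> (H2 -> H2)).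
Hypotheses (Xs : subspace X) (X1 : X idfun).
Hypotheses (alphal : linear_on X alpha) (betal : linear_on X beta).
Hypotheses (alpha1 : alpha idfun = idfun) (beta1 : beta idfun = idfun).
Hypothesis alphab : forall x, X x -> bop (alpha x).
Hypothesis pos : forall n (s : 'M[H0 -> H0]_n), (forall i j, X (s i j)) ->
  mxpos (map_mx alpha s) <-> mxpos (map_mx beta s).

Lemma linear_onB (V W : lmodType R[i]) (A : set V) (f : V -> W) x y :
  linear_on A f -> A x -> A y -> f (x - y) = f x - f y.
Proof. by move=> fl Ax Ay; rewrite addrC -scaleN1r fl// scaleN1r addrC. Qed.

(** Both [x - y] and [y - x] become zero, hence positive, under [beta], so they are positive under
    [alpha]; by [polarization] a vanishing quadratic form makes the operator zero. *)
Lemma transfer_wd x y : X x -> X y -> beta x = beta y -> alpha x = alpha y.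
Proof.
have half a b : X a -> X b -> beta a = beta b ->
    forall v, 0 <= dotp ((alpha a - alpha b) v) v.
  move=> Xa Xb ab; have Xab : X (a - b) by exact: (subspaceB Xs).
  apply/mxpos1; have := @pos 1 (const_mx (a - b)) _; rewrite !map_const_mx.
  rewrite (linear_onB alphal Xa Xb) (linear_onB betal Xa Xb) ab subrr.
  move=> /(_ _)[]; first by move=> i j; rewrite mxE.
  by move=> _; apply; apply/mxpos1 => v; rewrite dotp0l.
move=> Xx Xy xy; have Xxy : X (x - y) by exact: (subspaceB Xs).
apply/subr0_eq; rewrite -(linear_onB alphal Xx Xy); apply/funext => v.
apply: (polarization (alphab Xxy)) => {}v; rewrite (linear_onB alphal Xx Xy).
apply: le_anti; rewrite half// andbT -oppr_ge0.
have := half y x Xy Xx (esym xy) v.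
by rewrite -opprB -[X in 0 <= X -> _]/(dotp (- ((alpha x - alpha y) v)) v) linearNl.
Qed.

(** [alpha] and [beta] induce the same matrix order on [X], so sending [beta x] to [alpha x] is a
    well-defined complete order embedding. Composing [psi] with it leaves the image, and so the TRO,
    unchanged. *)
Lemma Delta_equivalent_transfer H (S : set (H -> H)) :
  Delta_equivalent S (alpha @` X) -> Delta_equivalent S (beta @` X).
Proof.
move=> [H' [K' [phi [psi [uS [pb pl p1 ppos] MM]]]]].
have /choice[g gP] : forall y, exists z, forall x,
    X x -> beta x = y -> z = alpha x.
  move=> y; have [[x [Xx xy]]|nx] := pselect (exists x, X x /\ beta x = y).
    by exists (alpha x) => x' Xx' xy'; apply: transfer_wd => //; rewrite xy.
  (* Off the image of [beta] the condition on [g] is vacuous and 0 is a default. *)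
  by exists 0 => x Xx xy; case: nx; exists x.
have gE x : X x -> g (beta x) = alpha x by move=> Xx; exact: gP.
have aX x : X x -> (alpha @` X) (alpha x) by move=> Xx; exists x.
exists H', K', phi, (psi \o g); split=> //; last first.
  suff -> : (psi \o g) @` (beta @` X) = psi @` (alpha @` X) by [].
  apply/seteqP; split=> _ [_ [x Xx <-] <-] /=.
    by rewrite gE//; exists (alpha x) => //; exact: aX.
  by exists (beta x); [exists x|rewrite /= gE].
split.
- by move=> _ [x Xx <-] /=; rewrite gE//; apply: pb; exact: aX.
- move=> k _ _ [x Xx <-] [y Xy <-] /=.
  have Xxy : X (k *: x + y) by case: Xs => _; apply.
  by rewrite -betal// !gE// alphal// pl//; exact: aX.
- by rewrite -beta1 /= gE// alpha1 p1.
- move=> n s sX.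
  have /choice[t tP] : forall ij : 'I_n * 'I_n, exists t,
      X t /\ beta t = s ij.1 ij.2.
    by move=> [i j]; have [t Xt ts] := sX i j; exists t.
  pose t' : 'M[H0 -> H0]_n := \matrix_(i, j) t (i, j).
  have Xt i j : X (t' i j) by rewrite mxE; case: (tP (i, j)).
  have -> : s = map_mx beta t'.
    by apply/matrixP => i j; rewrite !mxE; case: (tP (i, j)).
  have -> : map_mx (psi \o g) (map_mx beta t') = map_mx psi (map_mx alpha t').
    by apply/matrixP => i j; have := Xt i j; rewrite !mxE /= => Xtij; rewrite gE.
  rewrite -pos// ppos// => i j; rewrite mxE; exact: aX.
Qed.

End Transfer.

(** Serves the compressions to the complement of the identity, which act on the zero space; there
    any two maps coincide and the set of all maps is a suitable TRO. *)
Lemma Delta_equivalent_trivial H K (S : set (H -> H)) (T : set (K -> K)) :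
  (forall x : H, x = 0) -> (forall y : K, y = 0) -> S idfun -> T idfun ->
  Delta_equivalent S T.
Proof.
move=> H0 K0 S1 T1.
have tb (L M : hilbertType R) (f : L -> M) : (forall x : M, x = 0) -> bop f.
  move=> M0; split; first by move=> k x y; rewrite [LHS]M0 [RHS]M0.
  by exists 0 => x; rewrite [f x]M0 normr0 mul0r.
have te (L M : hilbertType R) (f g : L -> M) : (forall x : M, x = 0) -> f = g.
  by move=> M0; apply/funext => x; rewrite [f x]M0 [g x]M0.
have tid L (A : set (L -> L)) : (forall x : L, x = 0) -> ucoe A id.
  move=> L0; split=> // [s _|n s _]; first exact: tb.
  by rewrite map_mx_id.
have tcl (L M : hilbertType R) (A : set (L -> M)) f g :
    (forall x : M, x = 0) -> A g -> opclosure A f.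
  move=> M0 Ag; split; first exact: tb.
  move=> e e0; exists f; first by rewrite (te _ _ f g).
  by move=> x; rewrite subrr normr0 mulr_ge0// ltW.
have tls (V : lmodType R[i]) (A : set V) : lspan A 0 by move=> B [[]].
exists H, K, id, id; split; [exact: tid|exact: tid|].
rewrite !image_id; exists setT; split.
- by split=> // f _; exact: tb.
- by split; apply: tcl => //; exact: tls.
- by move=> a a' b t _ _ _ _; exact: tcl S1.
- by move=> a b b' s _ _ _ _; exact: tcl T1.
Qed.

End DeltaEquivalence.

(** * Compressions of the C*-envelope in its universal representation *)

Section EnvelopeCompression.
Context {R : realType} {H : hilbertType R} (S : set (H -> H)).
Variable E : envelope_data S.
Hypothesis Sos : operator_system S.

Let U := univ_space E.
Let A := cstar_env E.
Let rho := univ_map E.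
Let iota := env_map E.

Lemma env_ucoe : ucoe S iota. Proof. by case: (env_axiom E). Qed.

Lemma env_sub s : S s -> A (iota s).
Proof. by move=> Ss; apply: sub_gen_smallest; exists s. Qed.

Lemma env_map_bop : iota @` S `<=` bop.
Proof. by case: env_ucoe => + _ _ _ _ [s Ss <-]; exact. Qed.

Lemma env_cstar : cstar_subalgebra A.
Proof. exact: cstar_gen_cstar env_map_bop. Qed.

Lemma env_id : A idfun.
Proof.
have [_ _ <- _] := env_ucoe; apply: env_sub.
by case: Sos.
Qed.

Lemma env_rep : unital_rep A rho.
Proof. exact: universal_rep_unital env_cstar env_id (univ_axiom E). Qed.

(** The C*-envelope is generated by the image of [S], so commuting with that image passes to all of
    it. *)
Lemma env_commutes (p : projector U) :
  commutant (env_image E) p -> commutes_with A rho p.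
Proof.
move=> [_ pc]; apply: commutes_generators.
- exact: env_map_bop.
- by have [_ _ <- _] := env_ucoe; exists idfun => //; case: Sos.
- exact: (univ_axiom E).
by move=> _ [s Ss <-]; apply: pc; exists s.
Qed.

(** The bidual is the bicommutant of the represented algebra, so it commutes with every element of
    the commutant. *)
Lemma commutes_bidual (p : projector U) :
  commutes_with A rho p -> commutant (env_bidual E) p.
Proof.
move=> pc; split; first exact: proj_bop.
move=> a [_ ac]; apply: esym; apply: ac; split; first exact: proj_bop.
by move=> _ [b Ab <-]; exact: pc.
Qed.

Definition env_compress (p : projector U) (s : H -> H) :=
  compress (p := p) (rho (iota s)).

Arguments env_compress : clear implicits.

Lemma compression_env (p : projector U) :
  compression p (env_image E) = env_compress p @` S.
Proof. by rewrite /compression /env_image image_comp. Qed.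

Lemma env_compress_bop p s : S s -> bop (env_compress p s).
Proof.
move=> Ss; have br := rep_bop env_rep (env_sub Ss); have bp := proj_bop p.
split.
  move=> k x y; apply: val_inj.
  change (p (rho (iota s) (k *: val x + val y)) =
    k *: p (rho (iota s) (val x)) + p (rho (iota s) (val y))).
  by rewrite bopD// bopZ// bopD// bopZ.
have [M _ pM] := bop_bound (bop_comp br bp).
by exists M%:C => x; exact: pM.
Qed.

Lemma env_compress_linear p : linear_on S (env_compress p).
Proof.
have [_ il _ _] := env_ucoe; have bp := proj_bop p.
move=> k s t Ss St; apply/funext => x; apply: val_inj.
change (p (rho (iota (k *: s + t)) (val x)) =
  k *: p (rho (iota s) (val x)) + p (rho (iota t) (val x))).
rewrite il// (rep_lin env_rep); [|exact: env_sub|exact: env_sub].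
by rewrite bopD// bopZ.
Qed.

Lemma env_compress_id p : env_compress p idfun = idfun.
Proof.
have [_ _ i1 _] := env_ucoe.
apply/funext => x; apply: val_inj.
change (p (rho (iota idfun) (val x)) = val x).
by rewrite i1 (rep_id env_rep) prange_fixed.
Qed.

Lemma mxpos_compress p n (s : 'M[H -> H]_n) :
  mxpos (map_mx (env_compress p) s) <->
  form_pos_on rho p (fun i j => iota (s i j)).
Proof.
have dE (t : H -> H) (x y : prange p) :
    dotp (env_compress p t x) y = dotp (rho (iota t) (val x)) (val y).
  change (dotp (p (rho (iota t) (val x))) (val y) =
    dotp (rho (iota t) (val x)) (val y)).
  by rewrite (proj_sadj p) prange_fixed.
split=> spos x.
  move=> px; have := spos (fun i => PRange (introT eqP (px i))).
  by under eq_bigr do under eq_bigr do rewrite mxE dE.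
under eq_bigr do under eq_bigr do rewrite mxE dE.
by apply: (spos (fun i => val (x i))) => i; exact: prange_fixed.
Qed.

(** Agreement of [p] and [q] on single elements of the C*-algebra gives agreement on matrices over
    [S], by [pos_on_form], which is what the transfer asks for. *)
Lemma Delta_compression (p q : projector U) (L : hilbertType R)
    (T : set (L -> L)) :
  commutes_with A rho p -> commutes_with A rho q ->
  (forall c, A c -> pos_on rho p c <-> pos_on rho q c) ->
  Delta_equivalent T (compression p (env_image E)) ->
  Delta_equivalent T (compression q (env_image E)).
Proof.
move=> pc qc pq; rewrite !compression_env.
have [_ Ss _ S1] := Sos; have rU := env_rep.
apply: (Delta_equivalent_transfer Ss).
- exact: S1.
- exact: env_compress_linear.
- exact: env_compress_linear.
- exact: env_compress_id.
- exact: env_compress_id.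
- exact: env_compress_bop.
move=> n s sS; rewrite !mxpos_compress.
have As i j : A (iota (s i j)) by exact: env_sub.
by split; [apply: (pos_on_form rU rU pc qc)|apply: (pos_on_form rU rU qc pc)]
  => // c Ac /pq; exact.
Qed.

Lemma Delta_faithful_compression (p : projector U) (L : hilbertType R)
    (T : set (L -> L)) :
  commutes_with A rho p ->
  (forall c, A c -> pos_on rho p c -> forall x, 0 <= dotp (c x) x) ->
  Delta_equivalent T S -> Delta_equivalent T (compression p (env_image E)).
Proof.
move=> pc pf; rewrite compression_env -{1}[S]image_id.
have [Sb Ss _ S1] := Sos; have rU := env_rep.
have [_ _ _ ipos] := env_ucoe.
apply: (Delta_equivalent_transfer Ss).
- exact: S1.
- by [].
- exact: env_compress_linear.
- by [].
- exact: env_compress_id.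
- exact: Sb.
move=> n s sS; rewrite mxpos_compress map_mx_id// ipos//.
have As i j : A (iota (s i j)) by exact: env_sub.
(* The order of the C*-envelope on its own space is read as the identity representation compressed
   by the identity projection, so that [pos_on_form] applies. *)
have -> : mxpos (map_mx iota s) <->
    form_pos_on id (proj_id (env_space E)) (fun i j => iota (s i j)).
  split=> [spos x _|spos x].
    by have := spos x; under eq_bigr do under eq_bigr do rewrite mxE.
  by under eq_bigr do under eq_bigr do rewrite mxE; apply: (spos x).
have iU := id_rep env_cstar env_id.
have ic : commutes_with A id (proj_id (env_space E)) by [].
split; [apply: (pos_on_form iU rU ic pc)|apply: (pos_on_form rU iU pc ic)]
  => // c Ac cpos v pv.
  apply: (universal_rep_pos env_cstar env_id (univ_axiom E)) => // x.
  exact: cpos.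
exact: pf.
Qed.

Lemma env_hotel (p0 : projector U) : commutes_with A rho p0 ->
  (forall x, p0 x = x) \/
  exists p1 : projector U, [/\ commutes_with A rho p1,
    forall c, A c -> pos_on rho p0 c <-> pos_on rho p1 c
  & forall c, A c -> pos_on rho (projC p1) c -> forall x, 0 <= dotp (c x) x].
Proof. exact: hilbert_hotel env_cstar env_id (univ_axiom E). Qed.

Lemma commutes_projC (p : projector U) :
  commutes_with A rho p -> commutes_with A rho (projC p).
Proof.
move=> pc a Aa; apply/funext => x /=.
by rewrite (bopB _ _ (rep_bop env_rep Aa)) (commutes_withE _ pc Aa).
Qed.

Lemma pos_on_id_faithful c : A c -> pos_on rho (proj_id U) c ->
  forall x, 0 <= dotp (c x) x.
Proof.
move=> Ac cpos.
apply: (universal_rep_reflects_pos env_cstar (univ_axiom E) Ac) => x.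
exact: cpos.
Qed.

Lemma compression_id p : compression p (env_image E) idfun.
Proof.
by rewrite compression_env; exists idfun; [case: Sos|exact: env_compress_id].
Qed.

End EnvelopeCompression.

(** * Assembling the two projections *)

Lemma prange_projC_id (R : realType) (H : hilbertType R)
  (x : prange (projC (proj_id H))) : x = 0.
Proof.
apply: val_inj; have := prange_fixed x => /= <-.
by rewrite subrr.
Qed.

Theorem theorem8p9 (R : realType) (H K : hilbertType R)
    (S : set (H -> H)) (T : set (K -> K))
    (ES : envelope_data S) (ET : envelope_data T) :
  operator_system S -> operator_system T ->
  Delta_env_embeds S ET -> Delta_env_embeds T ES ->
  exists (p : projector (univ_space ET)) (q : projector (univ_space ES)),
    [/\ commutant (env_bidual ET) p,
        commutant (env_bidual ES) q,
        Delta_equivalent (compression p (env_image ET))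
          (compression q (env_image ES))
      & Delta_equivalent (compression (projC p) (env_image ET))
          (compression (projC q) (env_image ES))].
Proof.
move=> Sos Tos [p0 [/(env_commutes Tos) p0c Sp0]].
move=> [q0 [/(env_commutes Sos) q0c Tq0]].
(* The choice of both projections equal to 1 is settled first; afterwards [noD] refutes [p0 = 1] and
   [q0 = 1]. *)
have [D|noD] := pselect (Delta_equivalent
    (compression (proj_id (univ_space ET)) (env_image ET))
    (compression (proj_id (univ_space ES)) (env_image ES))).
  exists (proj_id _), (proj_id _); split=> //.
  - by apply: commutes_bidual.
  - by apply: commutes_bidual.
  - apply: Delta_equivalent_trivial;
      [exact: prange_projC_id|exact: prange_projC_id| |]; exact: compression_id.
have eq_range (L : hilbertType R) (X : set (L -> L)) (E : envelope_data X)
    (p q : projector (univ_space E)) : (forall x, p x = q x) ->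
    forall c, cstar_env E c -> pos_on (univ_map E) p c <-> pos_on (univ_map E) q c.
  by move=> pq c _; split=> cpos v pv; apply: cpos; rewrite ?pq// -pq.
have [p0id|[p1 [p1c p01 p1f]]] := env_hotel Tos p0c.
  (* With [p0] the identity, [S] is Delta-equivalent to the whole image of [T], and the identity
     compression for [S] is faithful; together they contradict [noD]. *)
  case: noD; apply: Delta_faithful_compression => //.
    exact: pos_on_id_faithful.
  apply: Delta_equivalent_sym; apply: Delta_compression Sp0 => //.
  exact: eq_range.
have [q0id|[q1 [q1c q01 q1f]]] := env_hotel Sos q0c.
  case: noD; apply: Delta_equivalent_sym.
  apply: Delta_faithful_compression => //; first exact: pos_on_id_faithful.
  apply: Delta_equivalent_sym; apply: Delta_compression Tq0 => //.
  exact: eq_range.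
have p1cc := commutes_projC Tos p1c; have q1cc := commutes_projC Sos q1c.
(* The complement of [p1] carries the order of [T] and is matched with [q1], which carries that of
   [q0]; [p1] carries the order of [p0] and is matched with the complement of [q1], which carries
   that of [S]. *)
exists (projC p1), q1; split.
- exact: commutes_bidual.
- exact: commutes_bidual.
- apply: Delta_equivalent_sym; apply: Delta_faithful_compression => //.
  by apply: Delta_equivalent_sym; exact: Delta_compression Tq0.
- apply: Delta_faithful_compression => //; apply: Delta_equivalent_sym.
  have Sp1 : Delta_equivalent S (compression p1 (env_image ET)).
    exact: Delta_compression Sp0.
  apply: Delta_compression Sp1 => //; first exact: commutes_projC.
  (* The double complement of [p1] agrees with [p1] pointwise, which gives the same positive
     elements. *)
  by apply: eq_range => x /=; rewrite subKr.
Qed.
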